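(* The problem $\textsc{ssmSAT}^{\le}_{\mathrm{bin}}[\mathfrak{S}_{\mathrm{diag}}]$ is PSPACE-hard: given a diagonal SSM $\mathcal{S}$ over an alphabet $\Sigma$ and $n\in\mathbb{N}$ encoded in binary, deciding whether there is $w\in\Sigma^*$ with $|w|\le n$ and $\mathcal{S}(w)=1$ is PSPACE-hard.
   Context: A feedforward neural network (FNN) is a composition of layers of nodes, each node computing $\mathbf{x}\mapsto\mathit{relu}(\sum_i c_ix_i+b)$ with $\mathit{relu}(x)=\max(0,x)$. An SSM layer of dimension $d$ is a tuple $(\mathbf{h}_0,\mathit{gate},\mathit{inc},\phi)$ with $\mathbf{h}_0\in\mathbb{R}^d$, $\mathit{gate}\colon\mathbb{R}^d\to\mathbb{R}^{d\times d}$, $\mathit{inc}\colon\mathbb{R}^d\to\mathbb{R}^d$, $\phi\colon\mathbb{R}^d\times\mathbb{R}^d\to\mathbb{R}^d$ (computed by an FNN); on input $\mathbf{x}_1\cdots\mathbf{x}_k$ it computes $\mathbf{h}_t=\mathit{gate}(\mathbf{x}_t)\mathbf{h}_{t-1}+\mathit{inc}(\mathbf{x}_t)$ and outputs $\mathbf{z}_t=\phi(\mathbf{h}_t,\mathbf{x}_t)$. An SSM over a finite alphabet $\Sigma$ with $L$ layers is a tuple $(\mathit{emb},l_1,\dots,l_L,\mathit{out})$ with $\mathit{emb}\colon\Sigma\to\mathbb{R}^d$, SSM layers $l_j$, and $\mathit{out}$ computed by an FNN; on $w=a_1\cdots a_k$ it sets $\mathbf{x}^0_i=\mathit{emb}(a_i)$,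 applies the layers in sequence, and outputs $\mathcal{S}(w)=\mathit{out}(\mathbf{x}^L_k)$. All weights and constants are finitely represented. $\mathfrak{S}_{\mathrm{diag}}$ is the class of SSM in which every $\mathit{gate}(\mathbf{x})$ is a diagonal matrix. The size of an SSM is $|\mathcal{S}|=|\Sigma|+L+d$, with syntactic representation polynomial in $|\mathcal{S}|$. *)

(* Defs.v *)
From HB Require Import structures.
From mathcomp Require Import all_boot all_order all_algebra.
From mathcomp Require Import reals.

Set Implicit Arguments.
Unset Strict Implicit.
Unset Printing Implicit Defensive.

Import Order.TTheory GRing.Theory Num.Theory.

Definition word := seq bool.

(* [None] is the blank; [inl b] are the input/output symbols; [G] collects the
   remaining work symbols of the machine. *)
Definition symbol (G : finType) : finType := option (bool + G).

Inductive move := GoLeft | Stay | GoRight.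

(* A two-way infinite tape: the cells left of the head (nearest first), the
   scanned cell, the cells right of the head.  Cells not listed are blank and
   have never been visited. *)
Record tape (S : Type) :=
  Tape { tape_left : seq S; tape_head : S; tape_right : seq S }.

Definition tape_write (S : Type) (a : S) (t : tape S) : tape S :=
  Tape (tape_left t) a (tape_right t).

Definition tape_move (S : Type) (blank : S) (m : move) (t : tape S) : tape S :=
  let: Tape l a r := t in
  match m with
  | GoLeft => Tape (behead l) (head blank l) (a :: r)
  | Stay => t
  | GoRight => Tape (a :: l) (head blank r) (behead r)
  end.

Definition tape_space (S : Type) (t : tape S) : nat :=
  (size (tape_left t) + size (tape_right t)).+1.

(* A machine with [k.+1] tapes; the input is on the first one. *)
Record tm (k : nat) := TM {
  tm_state : finType;
  tm_work : finType;
  tm_start : tm_state;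
  tm_halt : pred tm_state;
  tm_accept : pred tm_state;
  tm_trans : tm_state -> {ffun 'I_k.+1 -> symbol tm_work} ->
    tm_state * ('I_k.+1 -> symbol tm_work * move) }.

Section Run.
Variables (k : nat) (M : tm k).

Record config := Config {
  cf_state : tm_state M;
  cf_tape : 'I_k.+1 -> tape (symbol (tm_work M)) }.

Definition tm_init (x : word) : config :=
  let s := [seq Some (inl b) | b <- x] in
  Config (tm_start M)
    (fun j => if j == ord0 then Tape [::] (head None s) (behead s)
              else Tape [::] None [::]).

Definition tm_step (c : config) : config :=
  if tm_halt (cf_state c) then c else
  let: (q, act) :=
    tm_trans (cf_state c) [ffun j => tape_head (cf_tape c j)] in
  Config q
    (fun j => tape_move None (act j).2 (tape_write (act j).1 (cf_tape c j))).

Definition tm_run (x : word) (t : nat) : config := iter t tm_step (tm_init x).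

Definition tm_halted (c : config) : bool := tm_halt (cf_state c).

Definition tm_accepting (c : config) : bool := tm_accept (cf_state c).

Definition tm_space (c : config) : nat := \sum_j tape_space (cf_tape c j).

(* The output is the longest block of bits on the last tape that starts at the
   head and extends to the right. *)
Fixpoint leading_bits (s : seq (symbol (tm_work M))) : word :=
  if s is Some (inl b) :: s' then b :: leading_bits s' else [::].

Definition tm_output (c : config) : word :=
  let t := cf_tape c ord_max in leading_bits (tape_head t :: tape_right t).

End Run.

(* Every polynomial over the naturals is dominated by some [poly_bound c]. *)
Definition poly_bound (c n : nat) : nat := n ^ c + c.

(* Deterministic single-tape machines that halt on every input and use
   polynomial space. *)
Definition in_PSPACE (A : word -> Prop) : Prop :=
  exists (M : tm 0) (c : nat), forall x : word,
    (forall t, tm_space (tm_run M x t) <= poly_bound c (size x)) /\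
    (exists t, tm_halted (tm_run M x t) /\
               (tm_accepting (tm_run M x t) <-> A x)).

(* Deterministic multi-tape machines running in polynomial time. *)
Definition polytime (f : word -> word) : Prop :=
  exists (k : nat) (M : tm k) (c : nat), forall x : word,
    exists t, [/\ t <= poly_bound c (size x), tm_halted (tm_run M x t) &
                  tm_output (tm_run M x t) = f x].

(* A decision problem: a set of instances with an unambiguous binary encoding,
   together with the set of positive instances. *)
Record problem := Problem {
  pb_carrier : Type;
  pb_code : pb_carrier -> word;
  pb_code_inj : injective pb_code;
  pb_instance : pb_carrier -> Prop;
  pb_positive : pb_carrier -> Prop }.

(* The reduction only produces (codes of) genuine instances of [P]. *)
Definition reduces_to (A : word -> Prop) (P : problem) : Prop :=
  exists2 f : word -> word, polytime f &
    forall x, exists i : pb_carrier P,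
      [/\ pb_instance i, f x = pb_code i & A x <-> pb_positive i].

Definition PSPACE_hard (P : problem) : Prop :=
  forall A : word -> Prop, in_PSPACE A -> reduces_to A P.

Local Open Scope ring_scope.

(* Networks with input dimension [m] and output dimension [n]: one or more
   layers, each given by its weight matrix (one row per node) and its biases.
   Weights are rational so that networks are finite objects; they compute
   functions on real vectors (see [fnn_eval]). *)
Inductive fnn (m n : nat) : Type :=
| FnnLast of 'M[rat]_(n, m) & 'cV[rat]_n
| FnnCons (p : nat) of 'M[rat]_(p, m) & 'cV[rat]_p & fnn p n.

(* Not only [phi] but also [gate] and [inc] are presented by networks, to make
   a layer a finite object.  [phi] reads the stacked vector (h, x); [gate]
   outputs the entries of a [d * d] matrix in row-major order. *)
Record ssm_layer (d : nat) := SSMLayer {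
  sl_h0 : 'cV[rat]_d;
  sl_gate : fnn d (d * d);
  sl_inc : fnn d d;
  sl_phi : fnn (d + d) d }.

(* The alphabet is the set ['I_sm_sigma] of the first [sm_sigma] letters. *)
Record ssm := SSM {
  sm_sigma : nat;
  sm_depth : nat;
  sm_dim : nat;
  sm_emb : {ffun 'I_sm_sigma -> 'cV[rat]_sm_dim};
  sm_layers : sm_depth.-tuple (ssm_layer sm_dim);
  sm_out : fnn sm_dim 1 }.

Definition ssm_size (S : ssm) : nat := (sm_sigma S + sm_depth S + sm_dim S)%N.

Section Semantics.
Variable R : realType.

Definition real_mx m n (A : 'M[rat]_(m, n)) : 'M[R]_(m, n) := map_mx ratr A.

Definition relu (x : R) : R := Num.max 0 x.

Definition relu_layer m n (W : 'M[rat]_(n, m)) (b : 'cV[rat]_n)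
    (x : 'cV[R]_m) : 'cV[R]_n :=
  map_mx relu (real_mx W *m x + real_mx b).

Fixpoint fnn_eval m n (N : fnn m n) : 'cV[R]_m -> 'cV[R]_n :=
  match N with
  | FnnLast W b => relu_layer W b
  | FnnCons p W b N' => fun x => fnn_eval N' (relu_layer W b x)
  end.

Definition gate d (l : ssm_layer d) (x : 'cV[R]_d) : 'M[R]_d :=
  vec_mx (fnn_eval (sl_gate l) x)^T.

Definition inc d (l : ssm_layer d) (x : 'cV[R]_d) : 'cV[R]_d :=
  fnn_eval (sl_inc l) x.

Definition phi d (l : ssm_layer d) (h x : 'cV[R]_d) : 'cV[R]_d :=
  fnn_eval (sl_phi l) (col_mx h x).

Fixpoint layer_run d (l : ssm_layer d) (h : 'cV[R]_d) (xs : seq 'cV[R]_d) :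
    seq 'cV[R]_d :=
  if xs is x :: xs' then
    let h' := gate l x *m h + inc l x in
    phi l h' x :: layer_run l h' xs'
  else [::].

Definition layer_eval d (xs : seq 'cV[R]_d) (l : ssm_layer d) :
    seq 'cV[R]_d :=
  layer_run l (real_mx (sl_h0 l)) xs.

(* The output is undefined on the empty word, which has no last position. *)
Definition ssm_eval (S : ssm) (w : seq 'I_(sm_sigma S)) : option R :=
  if foldl (@layer_eval _) [seq real_mx (sm_emb S a) | a <- w] (sm_layers S)
    is x :: xs then Some (fnn_eval (sm_out S) (last x xs) ord0 ord0)
  else None.

Definition ssm_diagonal (S : ssm) : Prop :=
  forall (j : 'I_(sm_depth S)) (x : 'cV[R]_(sm_dim S)),
    is_diag_mx (gate (tnth (sm_layers S) j) x).

End Semantics.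

Local Close Scope ring_scope.

(* All encodings of data below are prefix codes, so that they can be
   concatenated; all dimensions and list lengths are spelled out in unary, so
   that an SSM code is at least as long as [ssm_size]. *)

Definition enc_seq (T : Type) (e : T -> word) (s : seq T) : word :=
  foldr (fun x acc => true :: e x ++ acc) [:: false] s.

(* Least significant digit first. *)
Definition digits (n : nat) : word :=
  mkseq (fun i => odd (n %/ 2 ^ i)) (trunc_log 2 n).+1.

Definition enc_nat (n : nat) : word := enc_seq (fun b => [:: b]) (digits n).

Definition enc_unary (n : nat) : word := iter n (cons true) [:: false].

Definition enc_int (z : int) : word := (z < 0)%R :: enc_nat `|z|%N.

Definition enc_rat (q : rat) : word := enc_int (numq q) ++ enc_int (denq q).

Definition enc_cV m (v : 'cV[rat]_m) : word :=
  enc_seq enc_rat [seq v i ord0 | i <- enum 'I_m].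

Definition enc_mx m n (A : 'M[rat]_(m, n)) : word :=
  enc_seq (fun i => enc_cV (row i A)^T) (enum 'I_m).

Fixpoint enc_fnn m n (N : fnn m n) : word :=
  match N with
  | FnnLast W b => false :: enc_cV b ++ enc_mx W
  | FnnCons p W b N' => true :: enc_cV b ++ enc_mx W ++ enc_fnn N'
  end.

Definition enc_layer d (l : ssm_layer d) : word :=
  enc_cV (sl_h0 l) ++ enc_fnn (sl_gate l) ++ enc_fnn (sl_inc l)
    ++ enc_fnn (sl_phi l).

Definition enc_ssm (S : ssm) : word :=
  enc_unary (sm_dim S)
    ++ enc_seq (@enc_cV _) [seq sm_emb S a | a <- enum 'I_(sm_sigma S)]
    ++ enc_seq (@enc_layer _) (sm_layers S)
    ++ enc_fnn (sm_out S).

Definition enc_instance (I : ssm * nat) : word := enc_ssm I.1 ++ enc_nat I.2.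

Definition prefix_code (T : Type) (e : T -> word) : Prop :=
  forall x y s t, e x ++ s = e y ++ t -> x = y /\ s = t.

Lemma enc_seq_prefix (T : Type) (e : T -> word) :
  prefix_code e -> prefix_code (enc_seq e).
Proof.
move=> He; elim=> [|x u IH] [|y v] s t //=; first by case.
by case; rewrite -!catA => /He[-> /IH[-> ->]].
Qed.

Lemma digits_inj : injective digits.
Proof.
have val n m : n < 2 ^ m ->
    \sum_(i < m) odd (n %/ 2 ^ i) * 2 ^ i = n.
  elim: m n => [|m IH] n; first by rewrite ltnS leqn0 big_ord0 => /eqP.
  move=> lt_n; rewrite big_ord_recl /= expn0 divn1 muln1.
  have lt_h : (n./2 < 2 ^ m)%N by rewrite ltn_half_double -mul2n -expnS.
  rewrite -[RHS]odd_double_half -[in RHS](IH _ lt_h) -mul2n big_distrr /=.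
  congr (_ + _); apply: eq_bigr => i _.
  by rewrite /bump /= add1n expnS divnMA divn2 mulnCA.
have dec n : n = (\sum_(i < size (digits n)) nth false (digits n) i * 2 ^ i)%N.
  rewrite size_mkseq -[LHS](val n (trunc_log 2 n).+1) ?trunc_log_ltn //.
  by apply: eq_bigr => i _; rewrite nth_mkseq.
by move=> n m eq_nm; rewrite (dec n) eq_nm -dec.
Qed.

Lemma enc_nat_prefix : prefix_code enc_nat.
Proof.
move=> n m s t /enc_seq_prefix[]; last by move=> /digits_inj.
by move=> a b u v [-> ->].
Qed.

Lemma enc_unary_prefix : prefix_code enc_unary.
Proof.
elim=> [|n IH] [|m] s t //=; first by case.
by case=> /IH[-> ->].
Qed.

Lemma enc_int_prefix : prefix_code enc_int.
Proof.
move=> z y s t eq_zy; have sgn_eq : (z < 0)%R = (y < 0)%R by case: eq_zy.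
have /enc_nat_prefix[abs_eq ->] := congr1 behead eq_zy; split=> //.
by rewrite [z]intEsign [y]intEsign sgn_eq abs_eq.
Qed.

Lemma enc_rat_prefix : prefix_code enc_rat.
Proof.
move=> p q s t; rewrite /enc_rat -!catA.
move=> /enc_int_prefix[num_eq /enc_int_prefix[den_eq ->]]; split=> //.
by rewrite -[p]divq_num_den num_eq den_eq divq_num_den.
Qed.

Lemma enc_cV_prefix m : prefix_code (@enc_cV m).
Proof.
move=> v w s t /(enc_seq_prefix enc_rat_prefix)[/eq_in_map eq_vw ->].
by split=> //; apply/colP => i; apply: eq_vw; rewrite mem_enum.
Qed.

Lemma enc_cV_dim m n (v : 'cV[rat]_m) (w : 'cV[rat]_n) s t :
  enc_cV v ++ s = enc_cV w ++ t -> m = n.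
Proof.
move=> /(enc_seq_prefix enc_rat_prefix)[/(congr1 size)].
by rewrite 2!size_map !size_enum_ord.
Qed.

Lemma enc_mx_prefix m n : prefix_code (@enc_mx m n).
Proof.
have enc_mxE (A : 'M[rat]_(m, n)) :
    enc_mx A = enc_seq (@enc_cV n) [seq (row i A)^T%R | i <- enum 'I_m].
  by rewrite /enc_mx; elim: (enum _) => //= i r ->.
move=> A B s t; rewrite !enc_mxE.
move=> /(enc_seq_prefix (@enc_cV_prefix n))[/eq_in_map eq_AB ->]; split=> //.
by apply/row_matrixP=> i; apply/trmx_inj/eq_AB; rewrite mem_enum.
Qed.

Lemma enc_fnn_prefix m n : prefix_code (@enc_fnn m n).
Proof.
elim=> {m n} [m n W b|m n p W b N IH] [W' b'|p' W' b' N'] s t //=.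
  by case; rewrite -!catA => /enc_cV_prefix[-> /enc_mx_prefix[-> ->]].
case; rewrite -!catA => eq_s; have eq_p := enc_cV_dim eq_s.
move: W' b' N' eq_s; rewrite -{}eq_p {p'} => W' b' N'.
by move=> /enc_cV_prefix[-> /enc_mx_prefix[-> /IH[-> ->]]].
Qed.

Lemma enc_layer_prefix d : prefix_code (@enc_layer d).
Proof.
move=> [h g i f] [h' g' i' f'] s t; rewrite /enc_layer /= -!catA.
move=> /enc_cV_prefix[-> /enc_fnn_prefix[-> /enc_fnn_prefix[->]]].
by move=> /enc_fnn_prefix[-> ->].
Qed.

Lemma enc_ssm_prefix : prefix_code enc_ssm.
Proof.
move=> [m L d e l o] [m' L' d' e' l' o'] s t; rewrite /enc_ssm /= -!catA.
move=> /enc_unary_prefix[eq_d]; rewrite -{}eq_d in e' l' o' *.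
move=> /(enc_seq_prefix (@enc_cV_prefix d))[eq_e].
move=> /(enc_seq_prefix (@enc_layer_prefix d))[eq_l].
move=> /enc_fnn_prefix[<- <-]; split=> //.
have eq_m : m = m' by have /(congr1 size) := eq_e; rewrite 2!size_map !size_enum_ord.
have eq_L : L = L' by rewrite -(size_tuple l) eq_l size_tuple.
rewrite -{}eq_m -{}eq_L in e' l' eq_e eq_l *.
move/val_inj: eq_l => <-; congr SSM.
by apply/ffunP => a; move/eq_in_map: eq_e; apply; rewrite mem_enum.
Qed.

Lemma enc_instance_inj : injective enc_instance.
Proof.
move=> [S n] [S' n']; rewrite /enc_instance /= => /enc_ssm_prefix[-> eq_n].
suff [-> _] : n = n' /\ [::] = [::] :> word by [].
by apply: enc_nat_prefix; rewrite eq_n.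
Qed.

(* The class of diagonal SSMs whose syntactic representation is polynomial in
   [ssm_size], the polynomial being [poly_bound c]. *)
Definition diag_class (R : realType) (c : nat) (S : ssm) : Prop :=
  ssm_diagonal R S /\ size (enc_ssm S) <= poly_bound c (ssm_size S).

(* Given an SSM of the class [C] and a length bound in binary, is there a word
   within this bound on which the SSM outputs 1? *)
Definition ssmSAT_le_bin (R : realType) (C : ssm -> Prop) : problem :=
  @Problem (ssm * nat)%type enc_instance enc_instance_inj
    (fun I => C I.1)
    (fun I => exists w : seq 'I_(sm_sigma I.1),
       size w <= I.2 /\ ssm_eval R w = Some 1%R).

(* Main.v *)
Require Import Defs.
From mathcomp Require Import all_boot all_order all_algebra.
From mathcomp Require Import reals.
From mathcomp Require Import zify lra.
From Stdlib Require Import FunctionalExtensionality.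

Set Implicit Arguments.
Unset Strict Implicit.
Unset Printing Implicit Defensive.

(** A machine running in polynomial space is turned into a string rewriting
    system: a configuration is a string of fixed length [K] with the control
    state in a cell of its own, and a step rewrites three adjacent cells.  The
    letters of the SSM are the pairs of a position and a triple of symbols.
    With gate and increment both the identity, the hidden vector of the first
    layer counts, for every cell and symbol, how often the symbol was consumed
    and how often it was produced there.  A letter is applicable iff the symbols
    it consumes are present, so that [relu (consumed - produced)] is an error
    term; the second layer sums the errors up, and the output is
    [relu (flag - errors)], which is 1 iff the last letter sees an accepting state
    and no error ever occurred.  A shortest rewriting sequence repeats no string,
    so words of length [2 ^ (K * number of symbols)] suffice, a bound whose binary
    encoding is short.

    The reduction is computed by structured programs on unary counters; the code
    of the SSM is given by nested loops over the cells in which all blocks are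
    constant words. *)

(** * Structured programs for Turing machines *)

(** Every FNN ends in [relu], so [inc] yields no negative entry, and under the identity gate a
    hidden entry never decreases: a cell cannot be overwritten. This is why consumption and
    production are counted separately and only their difference is read. The difference describes
    the cell as long as the word is a correct rewriting sequence; errors are nonnegative and added
    up, so nothing that happens after the first one can repair it. The sum takes a layer of its own
    because the output sees the last position only.

    Nothing forces a word to advance the machine at every letter. However, a rule without a state in
    the middle is the identity, and at most one letter with a state in the middle fits a string that
    shows a configuration, so a valid word can only follow the deterministic run, with pauses.

    The exponent of the class has to be fixed before the machine is known. All weights are 0, 1 or
    -1, so the length of the code is bounded in terms of the size of the SSM alone. *)

Section StructuredPrograms.
Variable k : nat.
Local Notation sym := (symbol void).
Local Notation tapes := ('I_k.+1 -> tape sym).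

Definition heads := {ffun 'I_k.+1 -> sym}.
Definition action := 'I_k.+1 -> sym * move.

Definition scan (T : tapes) : heads := [ffun j => tape_head (T j)].

Definition perform (a : action) (T : tapes) : tapes :=
  fun j => tape_move None (a j).2 (tape_write (a j).1 (T j)).

Definition idle (h : heads) : action := fun j => (h j, Stay).

Inductive prog :=
| Act of heads -> action
| Seq of prog & prog
| While of pred heads & prog
| If of pred heads & prog & prog.

(** The extra [None] of [While] and [If] is the test, a step of its own that leaves the tapes
    unchanged. [Seq] costs no step: the last action of [p] already leads to the start of [q]. *)
Fixpoint control (p : prog) : finType :=
  match p with
  | Act _ => unit
  | Seq p q => (control p + control q)%type
  | While _ p => option (control p)
  | If _ p q => option (control p + control q)%type
  end.

Fixpoint start p : control p :=
  match p with
  | Act _ => tt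
  | Seq p q => inl (start p)
  | While _ _ => None
  | If _ _ _ => None
  end.

(* The new control state [None] means that the program is left. *)
Fixpoint next p : control p -> heads -> option (control p) * action :=
  match p with
  | Act f => fun _ h => (None, f h)
  | Seq p q => fun s h =>
      match s with
      | inl s => let: (s', a) := next s h in
          (Some (if s' is Some s' then inl s' else inr (start q)), a)
      | inr s => let: (s', a) := next s h in (omap inr s', a)
      end
  | While b p => fun s h =>
      match s with
      | None => (if b h then Some (Some (start p)) else None, idle h)
      | Some s => let: (s', a) := next s h in (Some s', a)
      end
  | If b p q => fun s h =>
      match s with
      | None =>
          (Some (Some (if b h then inl (start p) else inr (start q))), idle h)
      | Some (inl s) => let: (s', a) := next s h in (omap (Some \o inl) s', a)
      | Some (inr s) => let: (s', a) := next s h in (omap (Some \o inr) s', a)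
      end
  end.

Inductive leaves p : control p -> tapes -> nat -> tapes -> Prop :=
| LeavesNow s T a : next s (scan T) = (None, a) -> leaves s T 1 (perform a T)
| LeavesLater s T s' a t T' : next s (scan T) = (Some s', a) ->
    leaves s' (perform a T) t T' -> leaves s T t.+1 T'.

Lemma perform_idle T : perform (idle (scan T)) T = T.
Proof.
by apply: functional_extensionality => j; rewrite /perform /= ffunE; case: (T j).
Qed.

Lemma leaves_act f T : leaves (start (Act f)) T 1 (perform (f (scan T)) T).
Proof. exact: LeavesNow. Qed.

Lemma leaves_seq_right p q (s : control q) T t T' :
  leaves s T t T' -> leaves (inr s : control (Seq p q)) T t T'.
Proof.
elim=> {s T t T'} [s T a eq_s|s T s' a t T' eq_s _ IH].
  by apply: (@LeavesNow (Seq p q)); rewrite /= eq_s.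
by apply: (@LeavesLater (Seq p q) _ _ _ a _ _ _ IH); rewrite /= eq_s.
Qed.

Lemma leaves_seq p q T t T' t' T'' :
  leaves (start p) T t T' -> leaves (start q) T' t' T'' ->
  leaves (start (Seq p q)) T (t + t') T''.
Proof.
move=> + /(@leaves_seq_right p); rewrite /=; move: (start p) => s leaves_p.
elim: leaves_p => {s T t T'} [s T a eq_s|s T s' a t T' eq_s _ IH] leaves_q.
  by rewrite add1n; apply: (@LeavesLater (Seq p q) _ _ _ a _ _ _ leaves_q); rewrite /= eq_s.
by rewrite addSn; apply: (@LeavesLater (Seq p q) _ _ _ a _ _ _ (IH leaves_q)); rewrite /= eq_s.
Qed.

Lemma leaves_while_false b p T :
  ~~ b (scan T) -> leaves (start (While b p)) T 1 T.
Proof.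
by move=> /negPf nb; rewrite -{2}(perform_idle T); apply: LeavesNow; rewrite /= nb.
Qed.

Lemma leaves_while_true (b : pred heads) p T t T' t' T'' :
  b (scan T) -> leaves (start p) T t T' ->
  leaves (start (While b p)) T' t' T'' ->
  leaves (start (While b p)) T (t + t').+1 T''.
Proof.
move=> bT leaves_p leaves_w.
apply: (@LeavesLater (While b p) _ _ (Some (start p)) (idle (scan T))).
  by rewrite /= bT.
rewrite perform_idle; move: (start p) leaves_p {bT} => s leaves_p.
elim: leaves_p leaves_w => {s T t T'} [s T a eq_s|s T s' a t T' eq_s _ IH] leaves_w.
  by rewrite add1n; apply: (@LeavesLater (While b p) _ _ _ a _ _ _ leaves_w); rewrite /= eq_s.
by rewrite addSn; apply: (@LeavesLater (While b p) _ _ _ a _ _ _ (IH leaves_w)); rewrite /= eq_s.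
Qed.

Lemma leaves_if (b : pred heads) p q T t T' :
  (if b (scan T) then leaves (start p) T t T' else leaves (start q) T t T') ->
  leaves (start (If b p q)) T t.+1 T'.
Proof.
case bT: (b _) => leaves_r;
  [apply: (@LeavesLater (If b p q) _ _ (Some (inl (start p))) (idle (scan T)))
  |apply: (@LeavesLater (If b p q) _ _ (Some (inr (start q))) (idle (scan T)))];
  rewrite /= ?bT // perform_idle.
  move: (start p) leaves_r => s {bT}.
  elim=> {s T t T'} [s T a eq_s|s T s' a t T' eq_s _ IH].
    by apply: (@LeavesNow (If b p q)); rewrite /= eq_s.
  by apply: (@LeavesLater (If b p q) _ _ _ a _ _ _ IH); rewrite /= eq_s.
move: (start q) leaves_r => s {bT}.
elim=> {s T t T'} [s T a eq_s|s T s' a t T' eq_s _ IH].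
  by apply: (@LeavesNow (If b p q)); rewrite /= eq_s.
by apply: (@LeavesLater (If b p q) _ _ _ a _ _ _ IH); rewrite /= eq_s.
Qed.

Definition machine p : tm k :=
  @TM k (option (control p)) void (Some (start p)) (pred1 None) pred0
    (fun s h => if s is Some s then next s h else (None, idle h)).

Lemma run_machine p (s : control p) T t T' : leaves s T t T' ->
  iter t (@tm_step k (machine p)) (@Config _ (machine p) (Some s) T) =
  @Config _ (machine p) None T'.
Proof.
elim=> {s T t T'} [s T a eq_s|s T s' a t T' eq_s _ IH].
  by rewrite /= /tm_step /= -/(scan T) eq_s.
by rewrite iterSr -IH /tm_step /= -/(scan T) eq_s.
Qed.

End StructuredPrograms.

(** * Counter programs *)

Definition upd (env : nat -> nat) (v x : nat) : nat -> nat :=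
  fun u => if u == v then x else env u.

Section CounterPrograms.
Variable m : nat.
Local Notation sym := (symbol void).
Local Notation tapes := ('I_m.+2 -> tape sym).
Local Notation prog := (prog m.+1).

Definition marker : sym := Some (inl true).
Definition bit (b : bool) : sym := Some (inl b).

(** The counters lie between the input tape [ord0] and the output tape [ord_max]. The condition
    [v < m] of the lemmas keeps [inord] away from both. *)
Definition counter_tape (v : nat) : 'I_m.+2 := inord v.+1.

Definition tape_action (j : 'I_m.+2) (f : sym -> sym * move) (h : heads m.+1) :
    action m.+1 :=
  fun i => if i == j then f (h i) else (h i, Stay).

Definition on_tape j f : prog := Act (tape_action j f).

Definition incr v := on_tape (counter_tape v) (fun a => (a, GoRight)).
Definition decr v := on_tape (counter_tape v) (fun a => (a, GoLeft)).
(** The output grows to the left, so every program below emits the last part of its word first. *)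
Definition emit b := on_tape ord_max (fun _ => (bit b, GoLeft)).
Definition input_right := on_tape ord0 (fun a => (a, GoRight)).
Definition input_left := on_tape ord0 (fun a => (a, GoLeft)).

Definition nonzero v : pred (heads m.+1) := fun h => h (counter_tape v) != marker.
Definition input_left_in : pred (heads m.+1) := fun h => h ord0 != None.
Definition input_bit : pred (heads m.+1) := fun h => h ord0 == bit true.

(* The value of a counter is the distance of its head to a marked cell. *)
Definition counts (n : nat) (t : tape sym) : Prop :=
  tape_head t :: tape_left t = rcons (nseq n None) marker /\
  exists u, tape_right t = nseq u None.

(* The head stands between the reversed [l] and [r]. *)
Definition reads (l r : word) (t : tape sym) : Prop :=
  (exists u, tape_left t = [seq bit b | b <- l] ++ nseq u None) /\
  (exists u, tape_head t :: tape_right t = [seq bit b | b <- r] ++ nseq u None).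

Definition writes (o : word) (t : tape sym) : Prop :=
  t = Tape [::] None [seq bit b | b <- o].

Record memory := Memory {
  counters : nat -> nat; input_before : word; input_after : word; output : word }.

Definition represents (s : memory) (T : tapes) : Prop :=
  [/\ reads (input_before s) (input_after s) (T ord0),
      forall v, v < m -> counts (counters s v) (T (counter_tape v)) &
      writes (output s) (T ord_max)].

(** A memory does not record how many blanks the heads have visited, hence the quantification over
    all tapes that represent it. The time is an upper bound only, so that branches of different
    length can be joined. *)
Definition exec (p : prog) (s s' : memory) (t : nat) : Prop :=
  forall T, represents s T ->
    exists T' t', [/\ t' <= t, leaves (start p) T t' T' & represents s' T'].

Lemma counter_tape_input v : v < m -> (counter_tape v == ord0) = false.
Proof. by move=> lt_vm; apply/negP => /eqP/(congr1 val); rewrite /= inordK //; lia. Qed.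

Lemma counter_tape_output v : v < m -> (counter_tape v == ord_max) = false.
Proof. by move=> lt_vm; apply/negP => /eqP/(congr1 val); rewrite /= inordK //; lia. Qed.

Lemma counter_tape_eq u v : u < m -> v < m ->
  (counter_tape u == counter_tape v) = (u == v).
Proof. by move=> lt_um lt_vm; rewrite -val_eqE /= !inordK //; lia. Qed.

Lemma perform_on_tape j f (T : tapes) i :
  perform (tape_action j f (scan T)) T i =
  if i == j then tape_move None (f (tape_head (T i))).2
                   (tape_write (f (tape_head (T i))).1 (T i))
  else T i.
Proof. by rewrite /perform /tape_action ffunE; case: eqP => //= _; case: (T i). Qed.

Lemma exec_weaken p s s' t t' : t <= t' -> exec p s s' t -> exec p s s' t'.
Proof.
move=> le_t ep T /ep[T' [u [le_u lv rp]]]; exists T', u; split=> //.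
exact: leq_trans le_t.
Qed.

Lemma exec_incr v s : v < m ->
  exec (incr v) s
    (Memory (upd (counters s) v (counters s v).+1)
       (input_before s) (input_after s) (output s)) 1.
Proof.
move=> lt_vm T [rd ct wr]; eexists _, 1; split; [by []|exact: leaves_act|].
split=> /= [|u lt_um|]; rewrite perform_on_tape.
- by rewrite eq_sym counter_tape_input.
- rewrite /upd counter_tape_eq //; case: eqP => [->|_]; last exact: ct.
  have [] := ct v lt_vm; case: (T _) => l a r /= eq_l [w ->].
  by split=> /=; [case: w => [|w] /=; rewrite eq_l|exists w.-1; case: w].
- by rewrite eq_sym counter_tape_output.
Qed.

Lemma exec_decr v s : v < m -> 0 < counters s v ->
  exec (decr v) s
    (Memory (upd (counters s) v (counters s v).-1)
       (input_before s) (input_after s) (output s)) 1.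
Proof.
move=> lt_vm gt0 T [rd ct wr]; eexists _, 1; split; [by []|exact: leaves_act|].
split=> /= [|u lt_um|]; rewrite perform_on_tape.
- by rewrite eq_sym counter_tape_input.
- rewrite /upd counter_tape_eq //; case: eqP => [->|_]; last exact: ct.
  have [] := ct v lt_vm; case: (T _) => l a r /=; case: (counters s v) gt0 => // n _.
  move=> /= [-> ->] [w ->]; split; last by exists w.+1.
  by case: n.
- by rewrite eq_sym counter_tape_output.
Qed.

Lemma exec_emit b s :
  exec (emit b) s
    (Memory (counters s) (input_before s) (input_after s) (b :: output s)) 1.
Proof.
move=> T [rd ct wr]; eexists _, 1; split; [by []|exact: leaves_act|].
split=> /= [|u lt_um|]; rewrite perform_on_tape.
- by [].
- by rewrite counter_tape_output //; exact: ct.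
- by rewrite eqxx wr.
Qed.

Lemma exec_input_right cs l b r o :
  exec input_right (Memory cs l (b :: r) o) (Memory cs (b :: l) r o) 1.
Proof.
move=> T [[[u eq_l] [w eq_r]] ct wr]; eexists _, 1; split; [by []|exact: leaves_act|].
split=> /= [|v lt_vm|]; rewrite perform_on_tape.
- rewrite eqxx; move: eq_l eq_r; case: (T _) => l' a r' /= -> [-> ->].
  split; first by exists u.
  by case: r {ct wr} => [|y r] /=; [exists w.-1.+1; case: w|exists w].
- by rewrite counter_tape_input //; exact: ct.
- by [].
Qed.

Lemma exec_input_left cs l b r o :
  exec input_left (Memory cs (b :: l) r o) (Memory cs l (b :: r) o) 1.
Proof.
move=> T [[[u eq_l] [w eq_r]] ct wr]; eexists _, 1; split; [by []|exact: leaves_act|].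
split=> /= [|v lt_vm|]; rewrite perform_on_tape.
- rewrite eqxx; move: eq_l eq_r; case: (T _) => l' a r' /= -> eq_r.
  by split; [exists u|exists w; rewrite /= eq_r].
- by rewrite counter_tape_input //; exact: ct.
- by [].
Qed.

Lemma exec_seq p q s s' s'' t t' :
  exec p s s' t -> exec q s' s'' t' -> exec (Seq p q) s s'' (t + t').
Proof.
move=> ep eq T /ep[T' [u [le_u lv /eq[T'' [u' [le_u' lv' rp]]]]]].
exists T'', (u + u'); split=> //; first exact: leq_add.
exact: leaves_seq lv lv'.
Qed.

Definition tests (b : pred (heads m.+1)) s x : Prop :=
  forall T, represents s T -> b (scan T) = x.

Lemma tests_nonzero v s : v < m -> tests (nonzero v) s (0 < counters s v).
Proof.
move=> lt_vm T [_ /(_ v lt_vm)[+ _] _]; rewrite /nonzero ffunE.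
by case: (counters s v) => [|n] /= [-> _].
Qed.

Lemma tests_input_left_in s : tests input_left_in s (input_after s != [::]).
Proof.
move=> T [[_ [u]]]; rewrite /input_left_in ffunE => + _ _.
by case: (input_after s) => [|b r]; [case: u => // u [-> _]|case=> ->].
Qed.

Lemma tests_input_bit cs l b r o : tests input_bit (Memory cs l (b :: r) o) b.
Proof.
move=> T [[_ [u]]]; rewrite /input_bit ffunE /= => -[-> _] _ _.
by case: b.
Qed.

Lemma exec_while b p (F : nat -> memory) n t :
  (forall i, i < n -> tests b (F i) true) -> tests b (F n) false ->
  (forall i, i < n -> exec p (F i) (F i.+1) t) ->
  exec (While b p) (F 0) (F n) (n * t.+1).+1.
Proof.
elim: n F => [|n IH] F testT testF body T rep0.
  exists T, 1; split=> //.
  by apply: leaves_while_false; rewrite (testF _ rep0).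
have [T1 [u [le_u lv1 rep1]]] := body 0 isT T rep0.
have [|||T2 [u' [le_u' lv2 rep2]]] := IH (fun i => F i.+1) _ _ _ T1 rep1.
- by move=> i lt_in; apply: testT.
- by [].
- by move=> i lt_in; apply: body.
exists T2, (u + u').+1; split=> //; first by rewrite mulSn; lia.
exact: leaves_while_true (testT 0 isT T rep0) lv1 lv2.
Qed.

Lemma exec_if b p q s s' x t : tests b s x ->
  exec (if x then p else q) s s' t -> exec (If b p q) s s' t.+1.
Proof.
move=> tb er T rep0; have [T' [u [le_u lv rep1]]] := er T rep0.
exists T', u.+1; split=> //; apply: leaves_if.
by rewrite (tb _ rep0); case: x {tb er} lv.
Qed.

End CounterPrograms.

(** * Generating words by nested loops *)

Section Generators.
Variable m : nat.
Local Notation prog := (prog m.+1).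

Definition skip : prog := Act (@idle m.+1).

Lemma exec_skip s : exec skip s s 1.
Proof.
move=> T rep0; exists T, 1; split=> //.
by rewrite -{2}(perform_idle T); apply: leaves_act.
Qed.

Definition incrs (L : seq nat) : prog := foldr (fun u => Seq (incr m u)) skip L.

(** The source is emptied. To copy a counter, a scratch counter is put into [L] and transferred
    back; an entry occurring twice in [L] receives twice the value. *)
Definition transfer v L : prog :=
  While (nonzero v) (Seq (decr m v) (incrs L)).

Lemma exec_incrs L s : all (gtn m) L ->
  exec (incrs L) s
    (Memory (fun u => counters s u + count_mem u L)
       (input_before s) (input_after s) (output s)) (size L).+1.
Proof.
elim: L s => [|v L IH] [cs l r o] /=.
  move=> _; suff -> : (fun u => cs u + 0) = cs by apply: exec_skip.
  by apply: functional_extensionality => u; rewrite addn0.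
case/andP=> lt_v ok; rewrite -[_.+2]add1n; apply: exec_seq; first exact: exec_incr.
have := IH (Memory (upd cs v (cs v).+1) l r o) ok; rewrite /=.
congr exec; congr Memory; apply: functional_extensionality => u.
by rewrite /upd eq_sym; case: eqP => [->|_]; lia.
Qed.

Lemma exec_transfer v L s : v < m -> all (gtn m) L -> v \notin L ->
  exec (transfer v L) s
    (Memory (fun u => if u == v then 0
                      else counters s u + count_mem u L * counters s v)
       (input_before s) (input_after s) (output s))
    (counters s v * (size L + 3)).+1.
Proof.
move=> lt_v ok vL; case: s => cs l r o /=.
pose F i := Memory (fun u => if u == v then cs v - i
                             else cs u + count_mem u L * i) l r o.
have -> : Memory cs l r o = F 0.
  congr Memory; apply: functional_extensionality => u.
  by rewrite muln0 addn0 subn0; case: eqP => [->|].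
have -> : Memory (fun u => if u == v then 0
                      else cs u + count_mem u L * cs v) l r o = F (cs v).
  by congr Memory; apply: functional_extensionality => u; rewrite subnn.
rewrite addn3; apply: exec_while => [i lt_i||i lt_i].
- by have := @tests_nonzero m _ (F i) lt_v;
    rewrite /= eqxx subn_gt0 lt_i.
- by have := @tests_nonzero m _ (F (cs v)) lt_v; rewrite /= eqxx subnn.
rewrite -[X in exec _ _ _ X]add1n; apply: exec_seq.
  by apply: exec_decr => //=; rewrite eqxx subn_gt0.
have := @exec_incrs L (Memory (upd (counters (F i)) v (counters (F i) v).-1) l r o) ok.
congr exec; congr Memory; apply: functional_extensionality => u.
rewrite /= /upd eqxx; case: eqP => [->|_]; last by rewrite mulnS; lia.
by rewrite (count_memPn vL); lia.
Qed.

Lemma memory_eq cs cs' l r o : cs =1 cs' -> Memory cs l r o = Memory cs' l r o.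
Proof. by move=> eq_cs; congr Memory; apply: functional_extensionality. Qed.

(* While the body runs for the [t]th time, [i] and [j] hold [V - t - 1] and [t]
   where [V] is the value of [v], and [v] holds [0]. *)
Definition for_loop v i j (body : prog) : prog :=
  Seq (transfer v [:: i])
    (Seq (While (nonzero i) (Seq (decr m i) (Seq body (incr m j))))
       (transfer j [:: v])).

Lemma exec_for_loop v i j body cs (l r o : nat -> word) t :
  v < m -> i < m -> j < m -> v != i -> v != j -> i != j ->
  cs i = 0 -> cs j = 0 ->
  (forall a, a < cs v ->
     let cs' := upd (upd (upd cs v 0) i (cs v - a.+1)) j a in
     exec body (Memory cs' (l a) (r a) (o a))
       (Memory cs' (l a.+1) (r a.+1) (o a.+1)) t) ->
  exec (for_loop v i j body) (Memory cs (l 0) (r 0) (o 0))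
    (Memory cs (l (cs v)) (r (cs v)) (o (cs v))) (cs v * (t + 11) + 3).
Proof.
move=> lt_v lt_i lt_j nvi nvj nij ci0 cj0 run_body.
pose E a b := upd (upd (upd cs v 0) i a) j b.
pose V := cs v.
apply: (@exec_weaken _ _ _ _ ((V * 4).+1 + ((V * (t + 2).+1).+1 + (V * 4).+1))).
  by rewrite -/V; lia.
apply: (@exec_seq _ _ _ _ (Memory (E V 0) (l 0) (r 0) (o 0))).
  have := @exec_transfer v [:: i] (Memory cs (l 0) (r 0) (o 0)) lt_v.
  rewrite /= lt_i inE nvi => /(_ isT isT); congr exec; apply: memory_eq => u.
  rewrite /E /upd; case: (eqVneq u j) => [->|_].
    by rewrite (eq_sym j) (negPf nvj) (negPf nij) cj0.
  case: (eqVneq u i) => [->|nui]; last by rewrite mul0n addn0.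
  by rewrite (eq_sym i) (negPf nvi) ci0 mul1n.
apply: (@exec_seq _ _ _ _ (Memory (E 0 V) (l V) (r V) (o V))).
  pose F a := Memory (E (V - a) a) (l a) (r a) (o a).
  have -> : Memory (E V 0) (l 0) (r 0) (o 0) = F 0 by rewrite /F subn0.
  have -> : Memory (E 0 V) (l V) (r V) (o V) = F V by rewrite /F subnn.
  have Fi a : counters (F a) i = V - a.
    by rewrite /= /E /upd (negPf nij) eqxx.
  apply: exec_while => [a lt_a||a lt_a].
  - by have := @tests_nonzero m _ (F a) lt_i; rewrite Fi subn_gt0 lt_a.
  - by have := @tests_nonzero m _ (F V) lt_i; rewrite Fi subnn.
  apply: (@exec_weaken _ _ _ _ (1 + (t + 1))); first by lia.
  apply: exec_seq.
    by apply: exec_decr => //; rewrite Fi subn_gt0.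
  apply: (@exec_seq _ _ _ _ (Memory (E (V - a.+1) a) (l a.+1) (r a.+1) (o a.+1))).
    have := run_body a lt_a; congr exec; apply: memory_eq => u.
    rewrite Fi /= /E /upd.
    by case: (eqVneq u i) => [->|//]; rewrite (negPf nij); lia.
  have := @exec_incr m _ (Memory (E (V - a.+1) a) (l a.+1) (r a.+1) (o a.+1)) lt_j.
  congr exec; apply: memory_eq => u; rewrite /= /E /upd eqxx.
  by case: eqP.
have := @exec_transfer j [:: v] (Memory (E 0 V) (l V) (r V) (o V)) lt_j.
rewrite /= lt_v inE eq_sym nvj => /(_ isT isT).
have -> : E 0 V j = V by rewrite /E /upd eqxx.
congr exec; apply: memory_eq => u.
rewrite /E /upd; case: (eqVneq u j) => [->|_]; first by rewrite cj0.
case: (eqVneq u i) => [->|nui]; first by rewrite (negPf nvi) ci0.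
by case: (eqVneq u v) => [->|_]; rewrite addn0 ?mul1n ?mul0n ?addn0.
Qed.

Fixpoint emits (w : word) : prog :=
  if w is b :: w' then Seq (emits w') (emit m b) else skip.

Lemma exec_emits w cs l r o :
  exec (emits w) (Memory cs l r o) (Memory cs l r (w ++ o)) (size w).+1.
Proof.
elim: w => [|b w IH] /=; first exact: exec_skip.
by rewrite -[(size w).+2]addn1; apply: exec_seq IH _; apply: exec_emit.
Qed.

(* Descriptions of words: [For v e] concatenates the values of [e] for all [t]
   below the value [V] of [v], with [t] and [V - t - 1] appended to the
   environment; [Inp w0 w1] spells the input with [w0] and [w1] as digits. *)
Inductive gen :=
| Lit of word
| Cat of gen & gen
| For of nat & gen
| Inp of word & word.

Definition enter (env : seq nat) v t : seq nat :=
  rcons (rcons (set_nth 0 env v 0) t) (nth 0 env v - t.+1).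

Variable x : word.

Fixpoint value (e : gen) (env : seq nat) : word :=
  match e with
  | Lit w => w
  | Cat e1 e2 => value e1 env ++ value e2 env
  | For v e => flatten [seq value e (enter env v t) | t <- iota 0 (nth 0 env v)]
  | Inp w0 w1 => flatten [seq if b then w1 else w0 | b <- x]
  end.

(* Counter [0] holds the length of the input and is never used as a bound. *)
Fixpoint well_scoped (s : nat) (e : gen) : bool :=
  match e with
  | Lit _ => true
  | Cat e1 e2 => well_scoped s e1 && well_scoped s e2
  | For v e => [&& 0 < v, v < s, s.+2 <= m & well_scoped s.+2 e]
  | Inp _ _ => (0 < s) && (s.+2 <= m)
  end.

Fixpoint compile (s : nat) (e : gen) : prog :=
  match e with
  | Lit w => emits w
  | Cat e1 e2 => Seq (compile s e2) (compile s e1)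
  | For v e => for_loop v s s.+1 (compile s.+2 e)
  | Inp w0 w1 =>
      Seq (for_loop 0 s s.+1
             (Seq (input_left m) (If (@input_bit m) (emits w1) (emits w0))))
          (for_loop 0 s s.+1 (input_right m))
  end.

Fixpoint cost (e : gen) (V : nat) : nat :=
  match e with
  | Lit w => (size w).+1
  | Cat e1 e2 => cost e2 V + cost e1 V
  | For v e => V * (cost e V + 11) + 3
  | Inp w0 w1 =>
      (V * (size w0 + size w1 + 14) + 3) + (V * 12 + 3)
  end.

(** The default of [nth 0 env] says that all counters beyond the environment are empty, so the next
    two are free for a loop. Both loop counters stay below the bound of the loop, so [V] remains a
    bound in the body. *)
Lemma exec_compile e env o V :
  well_scoped (size env) e -> nth 0 env 0 = size x -> all (geq V) env ->
  exec (compile (size env) e) (Memory (nth 0 env) (rev x) [::] o)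
    (Memory (nth 0 env) (rev x) [::] (value e env ++ o)) (cost e V).
Proof.
elim: e env o => [w|e1 IH1 e2 IH2|v e IH|w0 w1] env o /=.
- by move=> _ _ _; apply: exec_emits.
- case/andP=> ok1 ok2 env0 leV; apply: exec_seq (IH2 _ _ ok2 env0 leV) _.
  by rewrite -catA; apply: IH1.
- case/and4P=> v_gt0 lt_v le_m ok env0 leV.
  have le_vV : nth 0 env v <= V by apply: (allP leV); apply: mem_nth.
  apply: (@exec_weaken _ _ _ _ (nth 0 env v * (cost e V + 11) + 3)).
    by rewrite leq_add2r leq_mul2r le_vV orbT.
  pose n := nth 0 env v.
  (* [O a] is the output after [a] passes. Blocks appear from the last to the first, so pass [a]
     handles index [n - a.+1]; this is why the descending counter of the loop plays the role of the
     index in [enter]. *)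
  pose O a := flatten [seq value e (enter env v t) | t <- iota (n - a) a] ++ o.
  have -> : o = O 0 by [].
  rewrite -/n [flatten _ ++ _](_ : _ = O n); last first.
    by rewrite /O subnn.
  apply: (@exec_for_loop v (size env) (size env).+1 _ _ (fun=> rev x) (fun=> [::]) O);
    try lia; try by rewrite nth_default.
  move=> a lt_an /=.
  have eq_env : upd (upd (upd (nth 0 env) v 0) (size env) (n - a.+1)) (size env).+1 a
      = nth 0 (enter env v (n - a.+1)).
    apply: functional_extensionality => u.
    have szs : size (set_nth 0 env v 0) = size env.
      by rewrite size_set_nth; apply/maxn_idPr.
    rewrite /upd /enter !nth_rcons !size_rcons szs nth_set_nth /= -/n.
    case: (ltngtP u (size env)) => [lt_u|gt_u|->].
    + by rewrite ltnS ltnW // ltn_eqF // ltnS ltnW.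
    + case: eqP => [->|ne_u]; first by rewrite ltnn; lia.
      by rewrite nth_default ?(ltnW gt_u) // !if_same.
    + by rewrite ltnSn ltn_eqF.
  rewrite -/n eq_env.
  have size_env : size (enter env v (n - a.+1)) = (size env).+2.
    by rewrite !size_rcons size_set_nth; lia.
  have -> : O a.+1 = value e (enter env v (n - a.+1)) ++ O a.
    by rewrite /O /= subnSK // catA.
  rewrite -size_env; apply: IH; rewrite ?size_env //.
    rewrite /enter !nth_rcons !size_rcons size_set_nth nth_set_nth /=.
    by rewrite (ltn_eqF v_gt0) leq_max orbC; case: (size env) lt_v.
  rewrite /enter !all_rcons; apply/and3P; split=> /=; try lia.
  apply/(all_nthP 0) => u; rewrite size_set_nth nth_set_nth /= => lt_u.
  case: eqP => // _; apply: (allP leV); apply: mem_nth.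
  by move: lt_u; rewrite (maxn_idPr lt_v).
case/andP=> s_gt0 le_m env0 leV.
have le_nV : nth 0 env 0 <= V by apply: (allP leV); apply: mem_nth.
pose n := size x.
(* The input head starts behind the last letter; walking left meets the letters in the order in
   which the output is written. The second loop walks back. *)
pose O a := flatten [seq if b then w1 else w0 | b <- drop (n - a) x] ++ o.
apply: (@exec_seq _ _ _ _ (Memory (nth 0 env) [::] x (O n))).
  apply: (@exec_weaken _ _ _ _ (nth 0 env 0 * (size w0 + size w1 + 3 + 11) + 3)).
    by rewrite leq_add2r -addnA leq_mul2r le_nV orbT.
  have -> : o = O 0 by rewrite /O subn0 drop_size.
  have := @exec_for_loop 0 (size env) (size env).+1
    (Seq (input_left m) (If (@input_bit m) (emits w1) (emits w0))) (nth 0 env)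
    (fun a => rev (take (n - a) x)) (fun a => drop (n - a) x) O
    (size w0 + size w1 + 3).
  rewrite env0 -/n subn0 subnn take0 drop0 take_size drop_size.
  apply; try lia; try by rewrite nth_default.
  move=> a lt_an /=.
  have eq_n : n - a = (n - a.+1).+1 by lia.
  have lt_n : n - a.+1 < size x by rewrite -/n; lia.
  have eq_d : drop (n - a.+1) x = nth false x (n - a.+1) :: drop (n - a) x.
    by rewrite eq_n (drop_nth false).
  apply: (@exec_weaken _ _ _ _ (1 + (maxn (size w0) (size w1)).+2)); first lia.
  have -> : rev (take (n - a) x) = nth false x (n - a.+1) :: rev (take (n - a.+1) x).
    by rewrite eq_n (take_nth false) // rev_rcons.
  apply: exec_seq; first exact: exec_input_left.
  rewrite eq_d; apply: exec_if; first exact: tests_input_bit.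
  rewrite /O eq_d /= -catA; case: (nth _ _ _);
    (apply: exec_weaken; last exact: exec_emits); lia.
apply: (@exec_weaken _ _ _ _ (nth 0 env 0 * (1 + 11) + 3)).
  by rewrite leq_add2r leq_mul2r le_nV orbT.
rewrite [flatten _ ++ o](_ : _ = O n); last by rewrite /O subnn drop0.
have := @exec_for_loop 0 (size env) (size env).+1 (input_right m) (nth 0 env)
    (fun a => rev (take a x)) (fun a => drop a x) (fun=> O n) 1.
rewrite env0 take0 drop0 take_size drop_size.
apply; try lia; try by rewrite nth_default.
move=> a lt_an /=; rewrite (drop_nth false) // (take_nth false) // rev_rcons.
exact: exec_input_right.
Qed.

End Generators.

(** * Polynomial time *)

(** A base of at least 2 makes the bound monotone in the exponent at every [n], which gives closure
    under sums and products. *)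
Definition poly_bounded (f : nat -> nat) : Prop :=
  exists C D, forall n, f n <= C * n.+2 ^ D.

Lemma poly_bounded_le f g : (forall n, f n <= g n) -> poly_bounded g -> poly_bounded f.
Proof.
by move=> le_fg [C [D le_g]]; exists C, D => n; apply: leq_trans (le_fg n) (le_g n).
Qed.

Lemma poly_bounded_const a : poly_bounded (fun=> a).
Proof. by exists a, 0 => n; rewrite muln1. Qed.

Lemma poly_bounded_id : poly_bounded id.
Proof. by exists 1, 1 => n; lia. Qed.

Lemma poly_bounded_add f g : poly_bounded f -> poly_bounded g ->
  poly_bounded (fun n => f n + g n).
Proof.
move=> [C [D le_f]] [C' [D' le_g]]; exists (C + C'), (D + D') => n.
rewrite mulnDl; apply: leq_add.
  apply: leq_trans (le_f n) _; rewrite leq_mul2l; apply/orP; right.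
  by rewrite leq_exp2l // leq_addr.
apply: leq_trans (le_g n) _; rewrite leq_mul2l; apply/orP; right.
by rewrite leq_exp2l // leq_addl.
Qed.

Lemma poly_bounded_mul f g : poly_bounded f -> poly_bounded g ->
  poly_bounded (fun n => f n * g n).
Proof.
move=> [C [D le_f]] [C' [D' le_g]]; exists (C * C'), (D + D') => n.
by rewrite expnD mulnACA leq_mul.
Qed.

(** The additive constant covers [n = 0] and [n = 1], where the bounds are [C * 2 ^ D] and
    [C * 3 ^ D]. For [n >= 2], the inequalities [C <= n ^ C] and [n + 2 <= n ^ 2] bound the value by
    [n ^ (C + 2 * D)]. *)
Lemma poly_bounded_poly_bound f : poly_bounded f ->
  exists c, forall n, f n <= poly_bound c n.
Proof.
move=> [C [D le_f]]; exists (C * 3 ^ D + C + 2 * D) => n.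
apply: leq_trans (le_f n) _; rewrite /poly_bound.
case: n => [|[|n]].
- apply: leq_trans (leq_addl _ _); rewrite -addnA; apply: leq_trans (leq_addr _ _).
  by rewrite leq_mul2l; apply/orP; right; case: D {le_f} => // D; rewrite leq_exp2r.
- by apply: leq_trans (leq_addl _ _); rewrite -addnA leq_addr.
apply: leq_trans (leq_addr _ _); rewrite -addnA expnD.
apply: leq_trans (leq_pmull _ _); last by rewrite expn_gt0.
rewrite expnD expnM; apply: leq_mul.
  apply: leq_trans (ltnW (ltn_expl C (isT : 1 < 2))) _.
  by case: C {le_f} => // C; rewrite leq_exp2r.
case: D {le_f} => // D; rewrite leq_exp2r // expnS expn1; nia.
Qed.

Lemma poly_bounded_cost e V : poly_bounded V -> poly_bounded (fun n => cost e (V n)).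
Proof.
move=> poly_V; elim: e => [w|e1 IH1 e2 IH2|v e IH|w0 w1] /=.
- exact: poly_bounded_const.
- exact: poly_bounded_add.
- apply: poly_bounded_add (poly_bounded_const _); apply: poly_bounded_mul poly_V _.
  exact: poly_bounded_add IH (poly_bounded_const _).
- by do ?apply: poly_bounded_add; do ?apply: poly_bounded_mul poly_V _; apply: poly_bounded_const.
Qed.

(** * The machine of the reduction: space bound, number of cells, output *)

Section Reduction.
Variables (m c : nat) (e : gen).
Hypothesis le_8m : 8 <= m.
Hypothesis scoped_e : well_scoped m 6 e.
Local Notation prog := (prog m.+1).

Lemma lt_counter v : v < 8 -> v < m.
Proof. by move=> lt_v; apply: leq_trans lt_v le_8m. Qed.

Definition set_markers : prog :=
  Act (fun h i => if (i == ord0) || (i == ord_max) then (h i, Stay) else (marker, Stay)).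

Definition measure_input : prog :=
  While (@input_left_in m) (Seq (input_right m) (incr m 0)).

(* Counter [0] holds the input length [n], counter [1] the space bound [B],
   counter [2] the number of positions of a rewriting rule and counters [3], [4]
   and [5] the number of cells; counters [6] and [7] are scratch. *)
Definition registers n B p q t u := nth 0 [:: n; B; p; q; q; q; t; u].

(** Multiplies counter 1 by [n.+2]: each of its units adds [n] to counter 6, with counter 7 as the
    backup that restores counter 0, and then 2 more. *)
Definition mul_step : prog :=
  Seq (While (nonzero 1)
         (Seq (decr m 1)
            (Seq (transfer m 0 [:: 6; 7]) (Seq (transfer m 7 [:: 0]) (incrs m [:: 6; 6])))))
    (transfer m 6 [:: 1]).

Fixpoint power i : prog :=
  if i is i'.+1 then Seq (power i') mul_step else incr m 1.

(** Three copies of the number of cells are made because a loop empties its bound while it runs, and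
    the weight matrix of the gate network takes three nested loops over the cells. *)
Definition fan_out : prog :=
  Seq (transfer m 1 [:: 6; 2; 2]) (Seq (transfer m 6 [:: 1])
    (Seq (transfer m 0 [:: 6; 2]) (Seq (transfer m 6 [:: 0])
      (Seq (transfer m 2 [:: 6; 3; 4; 5]) (Seq (transfer m 6 [:: 2])
        (incrs m [:: 3; 3; 4; 4; 5; 5])))))).

Definition generate : prog :=
  Seq measure_input (Seq (power c.+1) (Seq fan_out (compile m 6 e))).

(** After the last [emit] the head stands on the blank left of the word, whereas [tm_output] reads
    from the head on. *)
Definition rewind_output : prog := on_tape ord_max (fun a => (a, GoRight)).

Definition reduction : prog := Seq set_markers (Seq generate rewind_output).

Lemma exec_transfer_to v L cs cs' l r o t :
  v < 8 -> all (gtn 8) L -> v \notin L -> t = (cs v * (size L + 3)).+1 ->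
  (forall u, cs' u = if u == v then 0 else cs u + count_mem u L * cs v) ->
  exec (transfer m v L) (Memory cs l r o) (Memory cs' l r o) t.
Proof.
move=> lt_v /allP ok vL -> eq_cs; rewrite (@memory_eq cs' _ _ _ _ eq_cs).
apply: (@exec_transfer m v L (Memory cs l r o)) => //; first exact: lt_counter.
by apply/allP => u /ok; apply: lt_counter.
Qed.

Lemma exec_incrs_to L cs cs' l r o :
  all (gtn 8) L -> (forall u, cs' u = cs u + count_mem u L) ->
  exec (incrs m L) (Memory cs l r o) (Memory cs' l r o) (size L).+1.
Proof.
move=> /allP ok eq_cs; rewrite (@memory_eq cs' _ _ _ _ eq_cs).
apply: (@exec_incrs m L (Memory cs l r o)).
by apply/allP => u /ok; apply: lt_counter.
Qed.

Lemma exec_mul_step n B l r o :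
  exec mul_step (Memory (registers n B 0 0 0 0) l r o)
    (Memory (registers n (B * n.+2) 0 0 0 0) l r o) (15 * (B.+1 * n.+2)).
Proof.
pose F i := Memory (registers n (B - i) 0 0 (i * n.+2) 0) l r o.
apply: (@exec_weaken _ _ _ _ ((B * (n * 9 + 6).+1).+1 + (B * n.+2 * 4).+1)); first nia.
apply: (@exec_seq _ _ _ _ (F B)).
  rewrite [Memory _ _ _ _](_ : _ = F 0); last by rewrite /F subn0.
  apply: exec_while => [i lt_i||i lt_i].
  - by have := @tests_nonzero m 1 (F i) (@lt_counter 1 isT); rewrite /= subn_gt0 lt_i.
  - by have := @tests_nonzero m 1 (F B) (@lt_counter 1 isT); rewrite /= subnn.
  apply: (@exec_weaken _ _ _ _ (1 + ((n * 5).+1 + ((n * 4).+1 + 3)))); first lia.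
  apply: exec_seq; first by apply: exec_decr; [apply: lt_counter|rewrite /= subn_gt0].
  apply: exec_seq.
    apply: (@exec_transfer_to _ _ _ (registers 0 (B - i.+1) 0 0 (i * n.+2 + n) n)) => //.
    by move=> [|[|[|[|[|[|[|[|u]]]]]]]]; rewrite /= /upd /registers /= ?nth_nil //; lia.
  apply: exec_seq.
    apply: (@exec_transfer_to _ _ _ (registers n (B - i.+1) 0 0 (i * n.+2 + n) 0)) => //.
    by move=> [|[|[|[|[|[|[|[|u]]]]]]]]; rewrite /= /registers /= ?nth_nil //; lia.
  apply: exec_incrs_to => //.
  by move=> [|[|[|[|[|[|[|[|u]]]]]]]]; rewrite /= /registers /= ?nth_nil //; lia.
apply: exec_transfer_to => //.
by move=> [|[|[|[|[|[|[|[|u]]]]]]]]; rewrite /= /registers /= ?nth_nil //; lia.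
Qed.

Lemma exec_power n i l r o :
  exec (power i) (Memory (registers n 0 0 0 0 0) l r o)
    (Memory (registers n (n.+2 ^ i) 0 0 0 0) l r o) (i * (30 * n.+2 ^ i)).+1.
Proof.
elim: i => [|i IH] /=.
  have := @exec_incr m 1 (Memory (registers n 0 0 0 0 0) l r o) (@lt_counter 1 isT).
  by congr exec; apply: memory_eq => -[|[|[|[|[|[|[|[|u]]]]]]]].
apply: exec_weaken; last first.
  by apply: exec_seq IH _; rewrite expnSr; apply: exec_mul_step.
have: 0 < n.+2 ^ i by rewrite expn_gt0.
rewrite expnS; nia.
Qed.

(** With [B = n.+2 ^ c.+1]: [B] blanks, the state, the [n] input cells and [B.+1] blanks. *)
Definition cells n := (2 * n.+2 ^ c.+1 + n).+2.

Lemma exec_fan_out n l r o : let B := n.+2 ^ c.+1 in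
  exec fan_out (Memory (registers n B 0 0 0 0) l r o)
    (Memory (registers n B (2 * B + n) (cells n) 0 0) l r o) (32 * B + 20 * n + 13).
Proof.
rewrite /cells; set B := _ ^ _; pose k := 2 * B + n.
apply: (@exec_weaken _ _ _ _ ((B * 6).+1 + ((B * 4).+1 + ((n * 5).+1 +
  ((n * 4).+1 + ((k * 7).+1 + ((k * 4).+1 + 7))))))); first by rewrite /k; lia.
apply: exec_seq.
  apply: (@exec_transfer_to _ _ _ (registers n 0 (2 * B) 0 B 0)) => //.
  by move=> [|[|[|[|[|[|[|[|u]]]]]]]]; rewrite /= /registers /= ?nth_nil //; lia.
apply: exec_seq.
  apply: (@exec_transfer_to _ _ _ (registers n B (2 * B) 0 0 0)) => //.
  by move=> [|[|[|[|[|[|[|[|u]]]]]]]]; rewrite /= /registers /= ?nth_nil //; lia.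
apply: exec_seq.
  apply: (@exec_transfer_to _ _ _ (registers 0 B k 0 n 0)) => //.
  by move=> [|[|[|[|[|[|[|[|u]]]]]]]]; rewrite /= /registers /= ?nth_nil //; lia.
apply: exec_seq.
  apply: (@exec_transfer_to _ _ _ (registers n B k 0 0 0)) => //.
  by move=> [|[|[|[|[|[|[|[|u]]]]]]]]; rewrite /= /registers /= ?nth_nil //; lia.
apply: exec_seq.
  apply: (@exec_transfer_to _ _ _ (registers n B 0 k k 0)) => //.
  by move=> [|[|[|[|[|[|[|[|u]]]]]]]]; rewrite /= /registers /= ?nth_nil //; lia.
apply: exec_seq.
  apply: (@exec_transfer_to _ _ _ (registers n B k k 0 0)) => //.
  by move=> [|[|[|[|[|[|[|[|u]]]]]]]]; rewrite /= /registers /= ?nth_nil //; lia.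
apply: exec_incrs_to => //.
by move=> [|[|[|[|[|[|[|[|u]]]]]]]]; rewrite /= /registers /= ?nth_nil //; lia.
Qed.

Lemma exec_measure_input x :
  exec measure_input (Memory (fun=> 0) [::] x [::])
    (Memory (registers (size x) 0 0 0 0 0) (rev x) [::] [::]) (size x * 3).+1.
Proof.
pose F i := Memory (registers i 0 0 0 0 0) (rev (take i x)) (drop i x) [::].
rewrite (@memory_eq _ (registers 0 0 0 0 0 0)); last first.
  by move=> [|[|[|[|[|[|[|[|u]]]]]]]]; rewrite /= /registers /= ?nth_nil.
have -> : Memory (registers 0 0 0 0 0 0) [::] x [::] = F 0 by rewrite /F take0 drop0.
have -> : Memory (registers (size x) 0 0 0 0 0) (rev x) [::] [::] = F (size x).
  by rewrite /F take_size drop_size.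
have left i : tests (@input_left_in m) (F i) (i < size x).
  have := @tests_input_left_in m (F i).
  by rewrite /= -size_eq0 size_drop subn_eq0 -ltnNge.
apply: exec_while => [i lt_i||i lt_i].
- by rewrite -lt_i.
- by rewrite -(ltnn (size x)).
apply: (@exec_weaken _ _ _ _ (1 + 1)) => //; apply: exec_seq.
  rewrite /F (drop_nth false) //; apply: exec_input_right.
rewrite /F (take_nth false) // rev_rcons.
have -> : registers i.+1 0 0 0 0 0 = upd (registers i 0 0 0 0 0) 0 i.+1.
  by apply: functional_extensionality => -[|[|[|[|[|[|[|[|u]]]]]]]].
exact: (@exec_incr m 0 (Memory _ _ _ _) (@lt_counter 0 isT)).
Qed.

Lemma set_markers_init x :
  represents (m := m) (Memory (fun=> 0) [::] x [::])
    (perform (fun i => if (i == ord0) || (i == ord_max)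
                       then (scan (cf_tape (tm_init (machine reduction) x)) i, Stay)
                       else (marker, Stay))
       (cf_tape (tm_init (machine reduction) x))).
Proof.
split=> [|v lt_v|]; rewrite /perform /=.
- rewrite ffunE /=; split; first by exists 0.
  by case: x => [|b x]; [exists 1|exists 0; rewrite /= cats0].
- by rewrite counter_tape_input // counter_tape_output //=; split=> //; exists 0.
- by rewrite eqxx ffunE.
Qed.

Lemma leading_bits_map (o : word) :
  leading_bits (M := machine reduction) [seq bit b | b <- o] = o.
Proof. by elim: o => //= b o ->. Qed.

Lemma run_reduction x : let n := size x in let B := n.+2 ^ c.+1 in
  exists t, [/\
    t <= 1 + ((n * 3).+1 + ((c.+1 * (30 * B)).+1 + (32 * B + 20 * n + 13 +
      (cost e (cells n) + 1)))),
    tm_halted (tm_run (machine reduction) x t) &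
    tm_output (tm_run (machine reduction) x t) =
    value x e [:: n; B; 2 * B + n; cells n; cells n; cells n]].
Proof.
move=> n B; set env := [:: _; _; _; _; _; _].
have := @exec_compile m x e env [::] (cells n) scoped_e erefl.
have -> : all (geq (cells n)) env.
  have: 0 < n.+2 ^ c by rewrite expn_gt0.
  by rewrite /= /cells /B expnS; do ?[apply/andP; split=> //]; nia.
have -> : nth 0 env = registers n B (2 * B + n) (cells n) 0 0.
  by apply: functional_extensionality => -[|[|[|[|[|[|[|[|u]]]]]]]]; rewrite /= /registers /= ?nth_nil.
move=> /(_ isT) run_e; rewrite cats0 in run_e.
pose T0 := cf_tape (tm_init (machine reduction) x).
have run_g : exec generate (Memory (fun=> 0) [::] x [::])
    (Memory (registers n B (2 * B + n) (cells n) 0 0) (rev x) [::] (value x e env))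
    ((n * 3).+1 + ((c.+1 * (30 * B)).+1 + (32 * B + 20 * n + 13 + cost e (cells n)))).
  apply: exec_seq; first exact: exec_measure_input.
  apply: exec_seq; first exact: exec_power.
  by apply: exec_seq run_e; apply: exec_fan_out.
have [T [t [le_t lv [_ _ wr]]]] := run_g _ (set_markers_init x).
have lv_all : leaves (start reduction) T0 (1 + (t + 1))
    (perform (tape_action ord_max (fun a => (a, GoRight)) (scan T)) T).
  apply: leaves_seq; first exact: leaves_act.
  by apply: leaves_seq lv _; apply: leaves_act.
have run_x : tm_run (machine reduction) x (1 + (t + 1)) = _ := run_machine lv_all.
exists (1 + (t + 1)); split.
- by lia.
- by rewrite run_x.
rewrite run_x /tm_output /= perform_on_tape eqxx wr /=.
by case: (value x e env) => [|b o] //=; rewrite leading_bits_map.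
Qed.

Lemma polytime_reduction f :
  (forall x, let n := size x in let B := n.+2 ^ c.+1 in
     f x = value x e [:: n; B; 2 * B + n; cells n; cells n; cells n]) ->
  polytime f.
Proof.
move=> eq_f.
have poly_B : poly_bounded (fun n => n.+2 ^ c.+1) by exists 1, c.+1 => n; rewrite mul1n.
have poly_n := poly_bounded_id.
have poly_c a := poly_bounded_const a.
have poly_cells : poly_bounded cells.
  rewrite /cells; apply: (@poly_bounded_le _ (fun n => 2 * n.+2 ^ c.+1 + n + 2)).
    by move=> n; lia.
  by do ?apply: poly_bounded_add => //; apply: poly_bounded_mul.
have poly_e := poly_bounded_cost e poly_cells.
pose bound n := 1 + ((n * 3 + 1) + ((c.+1 * (30 * n.+2 ^ c.+1) + 1) +
  (32 * n.+2 ^ c.+1 + 20 * n + 13 + (cost e (cells n) + 1)))).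
have [d le_d] : exists d, forall n, bound n <= poly_bound d n.
  apply: poly_bounded_poly_bound.
  rewrite /bound.
  repeat (first [apply: poly_bounded_add|apply: poly_bounded_mul|exact: poly_c|done]).
exists m.+1, (machine reduction), d => x.
have [t [le_t halt out]] := run_reduction x.
exists t; split=> //; last by rewrite out eq_f.
apply: leq_trans (le_d _); rewrite /bound; lia.
Qed.

End Reduction.

(** * Diagonal SSMs of rewriting systems *)

Import Order.TTheory GRing.Theory Num.Theory.

(** Coordinates follow the enumeration of [I]. For pairs it is lexicographic, so a vector over
    [index] is listed cell by cell, which the nested loops of the generator rely on. *)
Definition coord_cV (A : Type) (I : finType) (f : I -> A) : 'cV[A]_#|I| :=
  (\col_i f (enum_val i))%R.

Definition coord_mx (A : Type) (I J : finType) (f : I -> J -> A) : 'M[A]_(#|I|, #|J|) :=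
  (\matrix_(i, j) f (enum_val i) (enum_val j))%R.

Section RewritingSSM.
Local Open Scope ring_scope.
Variables (k : nat) (G : finType) (rule : G * G * G -> G * G * G).
Variables (accepting : pred G).

Definition string := {ffun 'I_k.+2 -> G}.
Definition letter := ('I_k * (G * G * G))%type.

(* Coordinates of the hidden vector, for every cell: [Some (true, g)] counts how
   often [g] was consumed there and [Some (false, g)] how often it was
   produced; [None] marks letters with an accepting symbol. *)
Definition slot := option (bool * G).
Definition index := ('I_k.+2 * slot)%type.

Definition pick3 (t : G * G * G) (j : nat) : G :=
  match j with 0%N => t.1.1 | 1%N => t.1.2 | _ => t.2 end.

(** The flag sits in the first cell of the window only, so that its sum over all cells is 0 or 1. *)
Definition window_slot (t : G * G * G) (j : nat) (o : slot) : rat :=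
  match o with
  | None => ((j == 0%N) && accepting t.1.2)%:R
  | Some (c, g) => (pick3 (if c then t else rule t) j == g)%:R
  end.

Definition emb_coord (l : letter) (i : index) : rat :=
  if (l.1 <= i.1 < l.1 + 3)%N then window_slot l.2 (i.1 - l.1) i.2 else 0.

(** The initial string counts as already produced. *)
Definition init_coord (s : string) (i : index) : rat :=
  if i.2 is Some (false, g) then (s i.1 == g)%:R else 0.

Definition phi_hidden (o o' : slot) : rat :=
  if o is Some (true, g) then (o' == Some (true, g))%:R - (o' == Some (false, g))%:R
  else 0.

(** The hidden vector that [phi] sees already contains the productions of the current letter. Adding
    them to the error cancels them there, so that a letter cannot consume what it produces
    itself. *)
Definition phi_input (o o' : slot) : rat :=
  match o with
  | Some (true, g) => (o' == Some (false, g))%:R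
  | Some (false, _) => 0
  | None => (o' == None)%:R
  end.

Definition out_slot (o : slot) : rat :=
  match o with Some (true, _) => -1 | Some (false, _) => 0 | None => 1 end.

Definition local_mx (w : slot -> slot -> rat) : 'M[rat]_#|{: index}| :=
  coord_mx (fun i j : index => if i.1 == j.1 then w i.2 j.2 else 0).

(** The gate network has zero weights and the identity matrix as bias, which [relu] preserves. The
    network of [inc] is the identity on nonnegative vectors only; embeddings and outputs of [phi]
    are such. The same layer serves twice: started at 0 it accumulates errors. *)
Definition rewriting_layer (h0 : index -> rat) : ssm_layer #|{: index}| :=
  SSMLayer (coord_cV h0) (FnnLast 0 (mxvec 1%:M)^T)
    (FnnLast (local_mx (fun o o' => (o == o')%:R)) 0)
    (FnnLast (row_mx (local_mx phi_hidden) (local_mx phi_input)) 0).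

Definition rewriting_ssm (s : string) : ssm :=
  @SSM #|{: letter}| 2 #|{: index}|
    [ffun a => coord_cV (emb_coord (enum_val a))]
    [tuple rewriting_layer (init_coord s); rewriting_layer (fun=> 0)]
    (FnnLast (\row_i out_slot (enum_val i).2) 0).

(** * What the two layers compute *)

Section Semantics.
Variable R : realType.
Implicit Types (f h : index -> R) (s : string) (l : letter).

Definition phi_coord h f (i : index) : R :=
  match i.2 with
  | Some (true, g) =>
      Num.max 0 (h i - h (i.1, Some (false, g)) + f (i.1, Some (false, g)))
  | Some (false, _) => 0
  | None => Num.max 0 (f i)
  end.

Fixpoint run_coord h (fs : seq (index -> R)) : seq (index -> R) :=
  if fs is f :: fs' then
    let h' i := h i + f i in phi_coord h' f :: run_coord h' fs'
  else [::].

Lemma mul_coord_mx (I J : finType) (w : I -> J -> rat) (f : J -> R) :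
  real_mx R (coord_mx w) *m coord_cV f =
  coord_cV (fun i => \sum_j ratr (w i j) * f j).
Proof.
apply/colP => i; rewrite !mxE [RHS]big_enum_val /=.
by apply: eq_bigr => j _; rewrite !mxE.
Qed.

Lemma sum_local (w : slot -> slot -> rat) (i : index) f :
  \sum_j ratr (if i.1 == j.1 then w i.2 j.2 else 0) * f j =
  \sum_o ratr (w i.2 o) * f (i.1, o).
Proof.
rewrite (eq_bigr (fun j : index =>
  (fun p o => ratr (if i.1 == p then w i.2 o else 0) * f (p, o)) j.1 j.2)); last by case.
rewrite -(pair_bigA _ (fun p o => ratr (if i.1 == p then w i.2 o else 0) * f (p, o))) /=.
rewrite (bigD1 i.1) //= [X in _ + X]big1 ?addr0 => [|p /negPf np].
  by apply: eq_bigr => o _; rewrite eqxx.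
by apply: big1 => o _; rewrite eq_sym np rmorph0 mul0r.
Qed.

Lemma sum_delta (I : finType) (a : I) (F : I -> R) :
  \sum_o ratr (o == a)%:R * F o = F a.
Proof.
rewrite (bigD1 a) //= eqxx rmorph1 mul1r big1 ?addr0 // => o /negPf ->.
by rewrite rmorph0 mul0r.
Qed.

Lemma sum_slot (F : slot -> R) : \sum_o F o =
  F None + (\sum_g F (Some (true, g)) + \sum_g F (Some (false, g))).
Proof.
rewrite (bigD1 None) //=; congr (_ + _).
rewrite (reindex_omap (@Some (bool * G)%type) id) /=; last by case.
rewrite (eq_bigl predT) => [|cg]; last by rewrite /= eqxx.
rewrite (eq_bigr (fun cg => (fun c g => F (Some (c, g))) cg.1 cg.2)); last by case.
by rewrite -(pair_bigA _ (fun c g => F (Some (c, g)))) big_bool.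
Qed.

Lemma rewriting_gate (b : index -> rat) x : gate (R := R) (rewriting_layer b) x = 1%:M.
Proof.
rewrite /gate /= /relu_layer /real_mx map_mx0 mul0mx add0r.
apply/matrixP => i j; rewrite !mxE mxvecE !mxE.
by case: (i == j); rewrite /relu ?rmorph1 ?rmorph0 (max_r ler01, maxxx).
Qed.

Lemma rewriting_inc (b : index -> rat) f : (forall i, 0 <= f i) ->
  inc (rewriting_layer b) (coord_cV f) = coord_cV f.
Proof.
move=> f_ge0; rewrite /inc /= /relu_layer /local_mx mul_coord_mx /real_mx map_mx0 addr0.
apply/colP => i; rewrite !mxE (sum_local (fun o o' => (o == o')%:R)) /relu.
under eq_bigr => o _ do rewrite eq_sym.
by rewrite (sum_delta _ (fun o => f (_, o))) -surjective_pairing max_r.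
Qed.

Lemma rewriting_phi (b : index -> rat) h f :
  phi (rewriting_layer b) (coord_cV h) (coord_cV f) = coord_cV (phi_coord h f).
Proof.
rewrite /phi /= /relu_layer /real_mx map_row_mx map_mx0 addr0 mul_row_col.
rewrite -!/(real_mx R _) /local_mx !mul_coord_mx.
apply/colP => i; rewrite !mxE !sum_local /relu /phi_coord.
case: (enum_val i) => p [[[] g]|] /=.
- rewrite (sum_delta _ (fun o => f (p, o))).
  under eq_bigr => o _ do rewrite rmorphB mulrBl.
  by rewrite sumrB !(sum_delta _ (fun o => h (p, o))).
- by rewrite !big1 ?addr0 ?maxxx // => o _; rewrite rmorph0 mul0r.
- rewrite (sum_delta _ (fun o => f (p, o))) big1 ?add0r // => o _.
  by rewrite rmorph0 mul0r.
Qed.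

Definition nonneg f := forall i, 0 <= f i.

Lemma run_layer (b : index -> rat) h fs : (forall f, List.In f fs -> nonneg f) ->
  layer_run (rewriting_layer b) (coord_cV h) [seq coord_cV f | f <- fs] =
  [seq coord_cV f | f <- run_coord h fs].
Proof.
elim: fs h => [|f fs IH] h //= ge0.
rewrite rewriting_gate mul1mx rewriting_inc; last by apply: ge0; left.
have -> : coord_cV h + coord_cV f = coord_cV (fun i => h i + f i).
  by apply/colP => i; rewrite !mxE.
by rewrite rewriting_phi IH // => f' in_fs; apply: ge0; right.
Qed.

Lemma phi_coord_ge0 h f : nonneg (phi_coord h f).
Proof. by rewrite /phi_coord => -[p [[[] g]|]] //=; rewrite le_max lexx. Qed.

Lemma run_coord_ge0 h fs f : List.In f (run_coord h fs) -> nonneg f.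
Proof.
elim: fs h => //= f' fs IH h [<-|/IH //]; exact: phi_coord_ge0.
Qed.

Lemma emb_coord_ge0 l i : 0 <= emb_coord l i.
Proof.
rewrite /emb_coord /window_slot; case: ifP => // _.
by case: i.2 => [[c g]|]; rewrite ler0n.
Qed.

Definition real_emb l (i : index) : R := ratr (emb_coord l i).

Lemma real_emb_ge0 l : nonneg (real_emb l).
Proof. by move=> i; rewrite /real_emb ler0q emb_coord_ge0. Qed.

Lemma real_coord_cV (I : finType) (f : I -> rat) :
  real_mx R (coord_cV f) = coord_cV (fun i => ratr (f i)).
Proof. by apply/colP => i; rewrite !mxE. Qed.

(* The error of the run up to some position is what the second layer
   accumulates. *)
Fixpoint errors h (fs : seq (index -> R)) : R :=
  if fs is f :: fs' then
    let h' i := h i + f i in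
    \sum_p \sum_g phi_coord h' f (p, Some (true, g)) + errors h' fs'
  else 0.

Definition reads_out f : R :=
  \sum_p (f (p, None) - \sum_g f (p, Some (true, g))).

Lemma fnn_eval_out s f :
  fnn_eval (sm_out (rewriting_ssm s)) (coord_cV f) ord0 ord0 =
  Num.max 0 (reads_out f).
Proof.
rewrite /= /relu_layer /real_mx map_mx0 addr0 !mxE /relu; congr Num.max.
transitivity (\sum_(i : index) ratr (out_slot i.2) * f i).
  by rewrite [RHS]big_enum_val /=; apply: eq_bigr => j _; rewrite !mxE.
rewrite (eq_bigr (fun i : index => (fun p o => ratr (out_slot o) * f (p, o)) i.1 i.2));
  last by case.
rewrite -(pair_bigA _ (fun p o => ratr (out_slot o) * f (p, o))) /=.
by apply: eq_bigr => p _; rewrite sum_slot /= rmorph1 mul1r -[RHS]addr0 -addrA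
  -[in RHS]sumrN; congr (_ + (_ + _)); [apply: eq_bigr|apply: big1] => g _;
  rewrite ?rmorphN ?rmorph1 ?rmorph0 ?mulN1r ?mul0r.
Qed.

(** Outputs of the first layer vanish at the coordinates [Some (false, _)], so in the second layer
    the subtraction and the [relu] have no effect and the errors just add up. The flag is read from
    the current input, not from the hidden vector, so only that of the last letter survives. The
    general [h2] is for the induction. *)
Lemma run_coord_twice h h2 f fs d :
  (forall p g, h2 (p, Some (false, g)) = 0) ->
  (forall p g, 0 <= h2 (p, Some (true, g))) -> (forall f', List.In f' (f :: fs) -> nonneg f') ->
  reads_out (last d (run_coord h2 (run_coord h (f :: fs)))) =
  \sum_p last f fs (p, None) - (\sum_p \sum_g h2 (p, Some (true, g)) + errors h (f :: fs)).
Proof.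
have phi_true h1 f1 p g : f1 (p, Some (false, g)) = 0 -> h1 (p, Some (false, g)) = 0 ->
    0 <= h1 (p, Some (true, g)) -> phi_coord h1 f1 (p, Some (true, g)) = h1 (p, Some (true, g)).
  by move=> f1_0 h1_0 h1_ge0; rewrite /phi_coord /= f1_0 h1_0 subr0 addr0 max_r.
have split_sum h1 h1' : \sum_p \sum_g (h1 (p, Some (true, g)) + h1' (p, Some (true, g))) =
    \sum_p \sum_g h1 (p, Some (true, g)) + \sum_p \sum_g h1' (p, Some (true, g)) :> R.
  by rewrite -big_split; apply: eq_bigr => p _; rewrite -big_split.
elim: fs f h h2 d => [|f' fs IH] f h h2 d h2_0 h2_ge0 ge0.
  rewrite /= addr0 -split_sum -sumrB; apply: eq_bigr => p _; congr (_ - _).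
    by rewrite /phi_coord /= !max_r //; do ?apply: (ge0 f); left.
  apply: eq_bigr => g _; rewrite phi_true // ?h2_0 ?add0r //.
  exact: addr_ge0 (h2_ge0 _ _) (phi_coord_ge0 _ _ _).
pose h' i := h i + f i; pose h2' i := h2 i + phi_coord h' f i.
apply: (etrans (IH f' h' h2' (phi_coord h2' (phi_coord h' f)) _ _ _)) => [p g|p g|f1 in1|].
- by rewrite /h2' h2_0 add0r.
- exact: addr_ge0 (h2_ge0 _ _) (phi_coord_ge0 _ _ _).
- by apply: ge0; right.
by congr (_ - _); rewrite split_sum -addrA.
Qed.

Lemma sum_real_emb_flag l : \sum_p real_emb l (p, None) = (accepting l.2.1.2)%:R.
Proof.
have lt_l : (l.1 < k.+2)%N by rewrite (leq_trans (ltn_ord l.1)) // -addn2 leq_addr.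
rewrite (bigD1 (Ordinal lt_l)) //= big1 ?addr0 => [|p np].
  by rewrite /real_emb /emb_coord /= leqnn subnn addnS ltnS leq_addr /= ratr_nat.
rewrite /real_emb /emb_coord /=; case: ifP => [/andP[le_p _]|_]; last exact: rmorph0.
rewrite /= subn_eq0; case: leqP => [ge_p|_]; last by rewrite ratr_nat.
by case/eqP: np; apply: val_inj; apply/eqP; rewrite eqn_leq le_p ge_p.
Qed.

Definition fits l s : bool :=
  [forall p : 'I_k.+2, (l.1 <= p < l.1 + 3)%N ==> (s p == pick3 l.2 (p - l.1))].

Definition fire l s : string :=
  [ffun p : 'I_k.+2 =>
     if (l.1 <= p < l.1 + 3)%N then pick3 (rule l.2) (p - l.1) else s p].

Fixpoint valid s (w : seq letter) : bool :=
  if w is l :: w' then fits l s && valid (fire l s) w' else true.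

Lemma errors_ge0 h fs : 0 <= errors h fs.
Proof.
elim: fs h => //= f fs IH h; apply: addr_ge0 => //.
by apply: sumr_ge0 => p _; apply: sumr_ge0 => g _; apply: phi_coord_ge0.
Qed.

(** The hypothesis is the invariant that produced minus consumed is the indicator of the current
    string. Under it the error at a cell and symbol is [relu] of the indicator of consumption minus
    the indicator of presence, hence nonzero exactly when an absent symbol is consumed. The first
    misfit makes the sum positive, and later errors are nonnegative. *)
Lemma errors_valid h s w :
  (forall p g, h (p, Some (false, g)) - h (p, Some (true, g)) = (s p == g)%:R) ->
  (errors h [seq real_emb l | l <- w] == 0) = valid s w.
Proof.
elim: w h s => [|l w IH] h s inv /=; first by rewrite eqxx.
rewrite paddr_eq0 ?errors_ge0 //; last first.
  by apply: sumr_ge0 => p _; apply: sumr_ge0 => g _; apply: phi_coord_ge0.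
set noerr := (X in X && _).
have -> : noerr = fits l s.
  rewrite /noerr psumr_eq0 => [|p _]; last first.
    by apply: sumr_ge0 => g _; apply: phi_coord_ge0.
  apply/allP/forallP => [noerr_all p|fit p _].
    apply/implyP => in_win; have := noerr_all p (mem_index_enum p).
    rewrite psumr_eq0 => [/allP/(_ (pick3 l.2 (p - l.1)) (mem_index_enum _))|g _];
      last exact: phi_coord_ge0.
    have := inv p (pick3 l.2 (p - l.1)).
    rewrite /= /phi_coord /= {1}/real_emb /emb_coord /= in_win /= eqxx ratr_nat.
    case: (s p == _) => // inv_p /eqP max0.
    have : h (p, Some (true, pick3 l.2 (p - l.1))) + 1 -
      (h (p, Some (false, pick3 l.2 (p - l.1))) + real_emb l (p, Some (false, pick3 l.2 (p - l.1))))
      + real_emb l (p, Some (false, pick3 l.2 (p - l.1))) <= 0.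
      by rewrite -[X in _ <= X]max0 le_max lexx orbT.
    by move: inv_p => /=; move: (real_emb _ _) => e inv_p; lra.
  apply/eqP; apply: big1 => g _; rewrite /phi_coord /=; apply/max_idPl.
  have := inv p g; have := fit p.
  set e := real_emb l (p, Some (false, g)).
  have : real_emb l (p, Some (true, g)) = 
    if (l.1 <= p < l.1 + 3)%N then (pick3 l.2 (p - l.1) == g)%:R else 0.
    by rewrite /real_emb /emb_coord /=; case: ifP => _; rewrite ?ratr_nat ?rmorph0.
  case: ifP => _ -> /=; last by move=> _; case: (s p == g) => /= inv_p; lra.
  by move=> /eqP <-; case: (s p == g) => inv_p; lra.
case fit: (fits l s) => //=.
apply: IH => p g; have := inv p g; have /forallP/(_ p) := fit.
rewrite /fire ffunE /real_emb /emb_coord /=.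
case: ifP => _ /=; last by rewrite rmorph0 !addr0.
move=> /eqP <-; rewrite !ratr_nat => inv_p.
by move: inv_p; case: (s p == g) => /=; case: (_ == g) => /= inv_p; lra.
Qed.

Lemma ssm_eval_rewriting s (w : seq 'I_#|{: letter}|) :
  ssm_eval R (S := rewriting_ssm s) w = Some 1 <->
  exists w' l, [/\ w = rcons [seq enum_rank l | l <- w'] (enum_rank l),
    valid s (rcons w' l) & accepting l.2.1.2].
Proof.
(* The value 1 is the maximum of [relu (b - e)], reached only for a set flag without any error. *)
have flag_bool (b : bool) e : 0 <= e -> (Some (Num.max 0 (b%:R - e)) = Some 1 :> option R) <-> b /\ e == 0.
  move=> e_ge0; split=> [[]|[-> /eqP->]]; last by rewrite subr0 max_r.
  case: b => /= [|]; last by rewrite sub0r max_l ?oppr_le0 // => /eqP; rewrite eq_sym oner_eq0.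
  by case: (leP 0 (1 - e)) => [_|_ /eqP]; [split=> //; apply/eqP; lra|rewrite eq_sym oner_eq0].
pose fs := [seq real_emb l | l <- [seq enum_val a | a <- w]].
pose h0 i : R := ratr (init_coord s i).
have fs_ge0 f : List.In f fs -> nonneg f.
  by rewrite /fs; elim: [seq _ | _ <- w] => //= l w' IH [<-|/IH //]; apply: real_emb_ge0.
have foldE : foldl (@layer_eval R _) [seq real_mx R (sm_emb (rewriting_ssm s) a) | a <- w]
    (sm_layers (rewriting_ssm s)) =
    [seq coord_cV f | f <- run_coord (fun=> ratr 0) (run_coord h0 fs)].
  rewrite /= /layer_eval /= !real_coord_cV.
  have -> : [seq real_mx R ([ffun a => coord_cV (emb_coord (enum_val a))] a) | a <- w] =
      [seq coord_cV f | f <- fs].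
    rewrite /fs -!map_comp; apply: eq_map => a /=; rewrite ffunE.
    exact: real_coord_cV.
  rewrite !run_layer //; exact: run_coord_ge0.
rewrite /ssm_eval foldE.
case: w @fs fs_ge0 foldE => [|a w] fs fs_ge0 _ /=.
  by split=> // -[w' [l []]]; case: w'.
rewrite last_map (fnn_eval_out s).
set z := phi_coord _ (phi_coord _ _).
pose l := enum_val a; pose ls := [seq enum_val b | b <- w].
rewrite [reads_out _](@run_coord_twice h0 (fun=> ratr 0) (real_emb l)
  [seq real_emb l' | l' <- ls] z); try by move=> *; rewrite /= rmorph0 ?lexx.
- rewrite last_map sum_real_emb_flag big1 ?add0r; last first.
    by move=> p _; apply: big1 => g _; rewrite rmorph0.
  rewrite -[_ :: _]/([seq real_emb l' | l' <- l :: ls]).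
  rewrite (flag_bool _ _ (errors_ge0 _ _)) (@errors_valid _ s); last first.
    by move=> p g; rewrite /h0 /init_coord /= rmorph0 subr0 ratr_nat.
  have eq_w : a :: w = [seq enum_rank l' | l' <- l :: ls].
    rewrite /l /ls /= enum_valK -map_comp; congr (_ :: _).
    by rewrite -[LHS]map_id; apply: eq_map => b /=; rewrite enum_valK.
  rewrite eq_w; split=> [[acc_l val_l]|[w' [l' [eq_l val_l acc_l]]]].
    exists (belast l ls), (last l ls); split=> //.
      by rewrite -map_rcons -lastI.
    by rewrite -lastI.
  move: eq_l; rewrite -map_rcons => /(inj_map enum_rank_inj) eq_l.
  by move: val_l acc_l; rewrite -eq_l -[l'](last_rcons l w') -eq_l.
- by move=> f' in_f; apply: fs_ge0.
Qed.

Lemma rewriting_diagonal s : ssm_diagonal R (rewriting_ssm s).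
Proof.
move=> j x; have -> : gate (tnth (sm_layers (rewriting_ssm s)) j) x = 1%:M.
  by case: j => -[|[|[]]] //= lt_j; rewrite (tnth_nth (rewriting_layer (fun=> 0))) /= rewriting_gate.
exact: scalar_mx_is_diag.
Qed.

End Semantics.
End RewritingSSM.

(** * Length of a shortest accepting word *)

Section ShortWords.
Variables (k : nat) (G : finType) (rule : G * G * G -> G * G * G).
Variables (accepting : pred G).
Implicit Types (s : string k G) (l : letter k G) (w : seq (letter k G)).

Definition result s w : string k G := foldl (fun s l => fire rule l s) s w.

Lemma valid_cat s w1 w2 :
  valid rule s (w1 ++ w2) = valid rule s w1 && valid rule (result s w1) w2.
Proof. by elim: w1 s => //= l w1 IH s; rewrite IH andbA. Qed.

Definition rewrites : rel (string k G) :=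
  fun s s' => [exists l, fits l s && (s' == fire rule l s)].

Lemma valid_path s w : valid rule s w ->
  exists2 p, path rewrites s p & last s p = result s w.
Proof.
elim: w s => [|l w IH] s /=; first by exists [::].
case/andP=> fit /IH[p path_p last_p]; exists (fire rule l s :: p) => //=.
by rewrite path_p andbT; apply/existsP; exists l; rewrite fit eqxx.
Qed.

Lemma path_valid s p : path rewrites s p ->
  exists w, [/\ size w = size p, valid rule s w & result s w = last s p].
Proof.
elim: p s => [|s' p IH] s /=; first by exists [::].
case/andP=> /existsP[l /andP[fit /eqP->]] /IH[w [size_w valid_w res_w]].
by exists (l :: w); rewrite /= fit valid_w size_w.
Qed.

(** A path without repetition has fewer edges than there are strings, and
    [#|G| ^ k.+2 <= 2 ^ (k.+2 * #|G|)]. A power of 2 is chosen because its binary code is easy to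
    generate. *)
Lemma short_valid_word s w : valid rule s w ->
  exists w', [/\ size w' < 2 ^ (k.+2 * #|G|), valid rule s w' & result s w' = result s w].
Proof.
case/valid_path=> p path_p <-; case: (shortenP path_p) => p' path_p' uniq_p' _.
have [w' [size_w' valid_w' res_w']] := path_valid path_p'.
exists w'; split=> //; rewrite size_w'; have /card_uniqP/= card_p := uniq_p'.
rewrite -card_p; apply: leq_trans (max_card _) _; rewrite card_ffun card_ord.
by rewrite mulnC expnM leq_exp2r // ltnW // ltn_expl.
Qed.

(** The last letter carries the flag and has to be kept; only the word before it is shortened, and
    the strict bound there leaves room for this letter. *)
Lemma short_accepting_word (R : realType) s :
  (exists w : seq 'I_#|{: letter k G}|,
    size w <= 2 ^ (k.+2 * #|G|) /\
    ssm_eval R (S := rewriting_ssm rule accepting s) w = Some 1%R) <->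
  (exists w l, valid rule s (rcons w l) /\ accepting l.2.1.2).
Proof.
split=> [[w [_ /ssm_eval_rewriting[w' [l [_ val acc]]]]]|[w [l [val acc]]]].
  by exists w', l.
move: val; rewrite -cats1 valid_cat => /andP[/short_valid_word[w' [small val' res]] val_l].
exists (rcons [seq enum_rank l | l <- w'] (enum_rank l)).
rewrite size_rcons size_map; split=> //; apply/ssm_eval_rewriting.
by exists w', l; split=> //; rewrite -cats1 valid_cat val' res.
Qed.

End ShortWords.

(** * Turing machines as rewriting systems *)

Section MachineRewriting.
Variables (M : tm 0).
Local Notation sym := (symbol (tm_work M)).
Local Notation G := (tm_state M + sym)%type.

(* The state of the machine occupies a cell of its own, to the left of the
   scanned cell. *)
Definition machine_rule (t : G * G * G) : G * G * G :=
  match t with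
  | (inr u, inl q, inr a) =>
      if tm_halt q then t else
      let: (q', act) := tm_trans q [ffun=> a] in
      let b := inr (act ord0).1 in
      match (act ord0).2 with
      | GoLeft => (inl q', inr u, b)
      | Stay => (inr u, inl q', b)
      | GoRight => (inr u, b, inl q')
      end
  | _ => t
  end.

(** [tm_accept] may also hold in states in which the machine does not halt. *)
Definition accepting_symbol : pred G :=
  fun g => if g is inl q then tm_halt q && tm_accept q else false.

Definition blank : G := inr None.

(** Only the left padding is listed; the right one is supplied by the default value of
    [nth blank]. *)
Definition layout i (c : config M) : seq G :=
  let t := cf_tape c ord0 in
  nseq i blank ++ map inr (rev (tape_left t)) ++
    inl (cf_state c) :: map inr (tape_head t :: tape_right t).

Lemma nth_map_inr (y : seq sym) n : nth blank (map inr y) n = inr (nth None y n).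
Proof. by elim: y n => [|a y IH] [|n] /=. Qed.

Definition state_pos i (c : config M) := i + size (tape_left (cf_tape c ord0)).

Lemma tm_space1 (c : config M) : tm_space c = tape_space (cf_tape c ord0).
Proof. by rewrite /tm_space big_ord1. Qed.

Lemma layout_state i c p q : nth blank (layout i c) p = inl q ->
  p = state_pos i c /\ q = cf_state c.
Proof.
rewrite /layout /state_pos !nth_cat size_nseq.
case: ltnP => [lt_p|le_ip]; first by rewrite nth_nseq if_same.
rewrite size_map size_rev; set r := p - i.
case: ltnP => [lt_r|]; first by rewrite nth_map_inr.
rewrite leq_eqVlt => /orP[/eqP eq_r|lt_r].
  by rewrite -eq_r subnn /= => -[<-]; split; rewrite ?eq_r ?subnKC.
by rewrite -(subnSK lt_r) /= -map_cons nth_map_inr.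
Qed.

Lemma layout_window i c (j : nat) : 0 < state_pos i c -> j < 3 ->
  nth blank (layout i c) ((state_pos i c).-1 + j) =
  let t := cf_tape c ord0 in
  pick3 (inr (head None (tape_left t)), inl (cf_state c), inr (tape_head t)) j.
Proof.
rewrite /layout /state_pos; case: (cf_tape c ord0) => l a r /=.
case: l => [|y l] /=.
  rewrite addn0; case: i => // i _ lt_j.
  rewrite -[i.+1]addn1 nseqD addn1 -catA nth_cat size_nseq /= ltnNge leq_addr addKn.
  by case: j lt_j => [|[|[|]]].
rewrite addnS /= rev_cons map_rcons cat_rcons !nth_cat size_nseq size_map size_rev => _ lt_j.
rewrite -addnA ltnNge leq_addr /= addKn ltnNge leq_addr /= addKn.
by case: j lt_j => [|[|[|]]].
Qed.

Lemma machine_rule_state t : machine_rule t = t \/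
  exists u q a, t = (inr u, inl q, inr a).
Proof.
case: t => -[[p|u] [q|b]] [r|a]; try by left.
by right; exists u, q, a.
Qed.

(* A step to the left of the first visited cell uses up one blank of the left
   padding. *)
Definition step_pad i (c : config M) :=
  if tm_halt (cf_state c) then i else
  let t := cf_tape c ord0 in
  let: (_, act) := tm_trans (cf_state c) [ffun=> tape_head t] in
  if (act ord0).2 is GoLeft then i - (nilp (tape_left t)) else i.

(** Old and new layout share what precedes and what follows the window, [pre] and [post]. When
    nothing visited lies left of the head, the first cell of the window is the last blank of the
    padding, whence [0 < state_pos i c]. *)
Lemma layout_step i c p : 0 < state_pos i c ->
  let t := cf_tape c ord0 in
  let P := (state_pos i c).-1 in
  nth blank (layout (step_pad i c) (tm_step c)) p =
  if P <= p < P + 3 then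
    pick3 (machine_rule (inr (head None (tape_left t)), inl (cf_state c),
                         inr (tape_head t))) (p - P)
  else nth blank (layout i c) p.
Proof.
move=> pos t P.
rewrite /step_pad /tm_step; case halt_c: (tm_halt _).
  rewrite /machine_rule halt_c; case: ifP => // /andP[le_P lt_P].
  have := @layout_window i c (p - P) pos; rewrite /= subnKC // => -> //.
  by rewrite ltn_subLR.
have -> : [ffun j => tape_head (cf_tape c j)] = [ffun=> tape_head t].
  by apply/ffunP => j; rewrite !ffunE ord1.
pose pre : seq G := nseq (i - nilp (tape_left t)) blank ++ map inr (rev (behead (tape_left t))).
pose post : seq G := map inr (tape_right t).
pose mid (u : G * G * G) := [:: u.1.1; u.1.2; u.2].
have size_pre : size pre = P.
  rewrite size_cat size_nseq size_map size_rev /P /state_pos -/t.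
  by move: pos; rewrite /state_pos -/t; case: (tape_left t) => [|y l] /=; lia.
have left_cells : nseq i blank ++ map inr (rev (tape_left t)) =
    rcons pre (inr (head None (tape_left t))).
  rewrite /pre; move: pos; rewrite /state_pos -/t; case: (tape_left t) => [|y l] /=.
    case: (i) => // n _; rewrite !cats0 subn1 -[n.+1]addn1 nseqD addn1 cats1; reflexivity.
  by rewrite subn0 rev_cons map_rcons -!rcons_cat.
have window u p' : nth blank (pre ++ mid u ++ post) p' =
    if P <= p' < P + 3 then pick3 u (p' - P) else nth blank (layout i c) p'.
  have -> : layout i c = pre ++
      mid (inr (head None (tape_left t)), inl (cf_state c), inr (tape_head t)) ++ post.
    by rewrite /layout -/t catA left_cells cat_rcons.
  rewrite !(nth_cat _ pre) size_pre; case: (ltnP p' P) => [lt_p|le_p] //=.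
  have [lt_p'|ge_p'] := ltnP p' (P + 3).
    by have : p' - P < 3 by [lia]; case: (p' - P) => [|[|[|]]].
  by have : 2 < p' - P by [lia]; case: (p' - P) => [|[|[|]]].
rewrite -window /machine_rule halt_c; case: (tm_trans _ _) => q' act /=.
rewrite /layout /= /tape_write.
have -> : cf_tape c ord0 = t by [].
move: left_cells; rewrite /pre /post; case: (t) => l a r /= left_cells.
case: (act ord0) => b [] /=.
- by rewrite -!catA.
- by rewrite catA left_cells cat_rcons.
rewrite rev_cons map_rcons cat_rcons catA left_cells cat_rcons !(nth_cat _ (_ ++ _)).
(* A move beyond the last visited cell lists a new blank, so the two lists differ in length and
   agree only through the default of [nth]. *)
case: r => // {left_cells}; case: ifP => // _.
by case: (p - _) => [|[|[|[|n]]]]; rewrite /= ?nth_nil.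
Qed.

Variables (k B : nat).
Hypothesis le_Bk : 2 * B <= k.
Implicit Types (s : string k G) (c : config M) (l : letter k G).

(** As long as the space is at most [B], the first inequality forces [0 < i], so the state has a
    left neighbour; the second keeps the window within the string. *)
Definition shows s c : Prop :=
  exists i, [/\ B < i + tm_space c, i <= B &
                forall p, s p = nth blank (layout i c) p].

Lemma fire_id s l : machine_rule l.2 = l.2 -> fits l s -> fire machine_rule l s = s.
Proof.
move=> rule_l /forallP fit; apply/ffunP => p; rewrite ffunE rule_l.
by case: ifP (fit p) => //= _ /eqP.
Qed.

(** A blank of the padding is used up only when the tape grows to the left, which adds one cell to
    the space. *)
Lemma step_pad_space i c : 0 < i ->
  step_pad i c <= i /\ i + tm_space c <= step_pad i c + tm_space (tm_step c).
Proof.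
rewrite !tm_space1 /step_pad /tm_step; case: (tm_halt _) => // i_gt0.
have -> : [ffun j => tape_head (cf_tape c j)] = [ffun=> tape_head (cf_tape c ord0)].
  by apply/ffunP => j; rewrite !ffunE ord1.
case: (tm_trans _ _) => q act /=; rewrite /tape_write /tape_space.
case: (cf_tape c ord0) => l a r /=; case: (act ord0) => b [] //=; rewrite ?size_behead.
  by case: l => [|y l] /=; lia.
by split=> //; lia.
Qed.

(** Uniqueness holds because a string that shows a configuration has a single state cell: it fixes
    the position of the letter, and the string then fixes the triple. *)
Lemma shows_letter s c : tm_space c <= B -> shows s c ->
  exists l, [/\ fits l s, l.2.1.2 = inl (cf_state c),
    shows (fire machine_rule l s) (tm_step c) &
    forall l' q, fits l' s -> l'.2.1.2 = inl q -> l' = l].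
Proof.
move=> le_B [i [lt_B le_i eq_s]].
have i_gt0 : 0 < i by lia.
have pos : 0 < state_pos i c by rewrite /state_pos; lia.
have lt_k : (state_pos i c).-1 < k.
  by move: le_B; rewrite tm_space1 /tape_space /state_pos; lia.
pose t := cf_tape c ord0.
pose l : letter k G := (Ordinal lt_k,
  (inr (head None (tape_left t)), inl (cf_state c), inr (tape_head t))).
have fits_l : fits l s.
  apply/forallP => p; apply/implyP => /= /andP[le_p lt_p]; rewrite eq_s.
  have := @layout_window i c (p - (state_pos i c).-1) pos.
  by rewrite /= subnKC // => ->; rewrite ?ltn_subLR.
exists l; split=> // [|l' q fits_l' mid_l'].
  have [le_pad le_space] := step_pad_space c i_gt0.
  exists (step_pad i c); split; [lia|lia|move=> p].
  by rewrite ffunE layout_step //= eq_s.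
have lt_l' : l'.1 < k.+1 by rewrite ltnW // ltnS.
have := forallP fits_l' (Ordinal (lt_l' : l'.1.+1 < k.+2)).
rewrite /= subSnn /= mid_l'; have -> : l'.1 <= l'.1.+1 < l'.1 + 3 by lia.
rewrite eq_s /= => /eqP/layout_state[eq_p _].
have eq_P : l'.1 = l.1 by apply: val_inj; rewrite /= -eq_p.
have eq_pick j : j < 3 -> pick3 l'.2 j = pick3 l.2 j.
  move=> lt_j; have lt_jk : l.1 + j < k.+2.
    by rewrite /=; lia.
  have := forallP fits_l (Ordinal lt_jk); have := forallP fits_l' (Ordinal lt_jk).
  rewrite eq_P /= leq_addr ltn_add2l lt_j addKn /= => /eqP <- /eqP <-.
  by [].
move: (eq_pick 0 isT) (eq_pick 1 isT) (eq_pick 2 isT) eq_P.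
rewrite /l /=; case: l' {fits_l' lt_l' mid_l' eq_p eq_pick} => p [[u v] w] /=.
by move=> -> -> -> ->.
Qed.

(** A letter that leaves its triple unchanged keeps both string and configuration; any other one has
    a state in the middle and is the letter that simulates the step. *)
Lemma valid_sound s c w l : (forall t, tm_space (iter t (@tm_step 0 M) c) <= B) ->
  shows s c -> valid machine_rule s (rcons w l) -> accepting_symbol l.2.1.2 ->
  exists t, let c' := iter t (@tm_step 0 M) c in tm_halted c' && tm_accepting c'.
Proof.
elim: w s c => [|l' w IH] s c space_c sh /=.
  rewrite andbT; have [l0 [fits_l0 mid_l0 _ uniq_l0]] := shows_letter (space_c 0) sh.
  move=> fits_l; case mid_l: (l.2.1.2) => [q|//] /= acc_q; exists 0.
  have eq_l := uniq_l0 _ _ fits_l mid_l; move: mid_l acc_q.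
  by rewrite eq_l mid_l0 => -[<-].
case/andP=> fits_l' val_w acc_l.
have [l0 [_ _ sh0 uniq_l0]] := shows_letter (space_c 0) sh.
case: (machine_rule_state l'.2) => [rule_l'|[u [q [a eq_l']]]].
  by apply: IH val_w acc_l; rewrite ?fire_id.
have eq_l := uniq_l0 l' q fits_l' (congr1 (fun t => t.1.2) eq_l').
rewrite eq_l in val_w.
have space_c' n : tm_space (iter n (@tm_step 0 M) (tm_step c)) <= B.
  by rewrite -iterSr.
have [t acc_t] := IH _ _ space_c' sh0 val_w acc_l.
by exists t.+1; rewrite iterSr.
Qed.

Lemma valid_complete s c t : (forall t, tm_space (iter t (@tm_step 0 M) c) <= B) ->
  shows s c -> let c' := iter t (@tm_step 0 M) c in
  tm_halted c' -> tm_accepting c' ->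
  exists w l, valid machine_rule s (rcons w l) /\ accepting_symbol l.2.1.2.
Proof.
elim: t s c => [|t IH] s c space_c sh /= halt_c acc_c.
  have [l [fits_l mid_l _ _]] := shows_letter (space_c 0) sh.
  by exists [::], l; rewrite /= fits_l mid_l /=; split=> //; apply/andP.
have [l [fits_l _ sh' _]] := shows_letter (space_c 0) sh.
rewrite -iterS iterSr in halt_c acc_c.
have space_c' n : tm_space (iter n (@tm_step 0 M) (tm_step c)) <= B.
  by rewrite -iterSr.
have [w [l' [val_w acc_l]]] := IH _ _ space_c' sh' halt_c acc_c.
by exists (l :: w), l'; rewrite /= fits_l.
Qed.

End MachineRewriting.

(** * The code of the SSM *)

(** Pairs are enumerated lexicographically, so a list over a product becomes two nested loops. *)
Lemma enum_prod_map (A B : finType) (T : Type) (g : A * B -> seq T) :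
  flatten [seq g i | i <- enum {: A * B}] =
  flatten [seq flatten [seq g (a, b) | b <- enum B] | a <- enum A].
Proof.
have -> : enum {: A * B} = [seq (a, b) | a <- enum A, b <- enum B].
  by rewrite [LHS]enumT unlock.
elim: (enum A) => //= a s IH.
by rewrite map_cat flatten_cat -IH -map_comp.
Qed.

Lemma map_enum_val (I : finType) (T : Type) (f : I -> T) :
  [seq f (enum_val i) | i <- enum 'I_#|I|] = [seq f i | i <- enum I].
Proof.
rewrite (map_comp f enum_val); congr map.
have [i0|no_i] := pickP (@predT 'I_#|I|); last first.
  have eq0 : #|I| = 0 by case: #|I| no_i => // n /(_ ord0).
  have -> : enum I = [::] by apply: size0nil; rewrite -cardE.
  by apply: size0nil; rewrite size_map size_enum_ord.
pose d := enum_val i0 => _.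
rewrite (eq_map (enum_val_nth d)) (map_comp (nth d (enum I)) val) val_enum_ord.
by rewrite cardE -[RHS](mkseq_nth d) /mkseq.
Qed.

Lemma map_mxvec (T : Type) m n (A : 'M[T]_(m, n)) (U : Type) (f : T -> U) :
  [seq f (mxvec A ord0 i) | i <- enum 'I_(m * n)] =
  [seq f (A ij.1 ij.2) | ij <- enum {: 'I_m * 'I_n}].
Proof.
have -> : enum 'I_(m * n) =
    [seq cast_ord (mxvec_cast m n) i | i <- enum 'I_#|{: 'I_m * 'I_n}|].
  apply: (inj_map val_inj); apply: etrans (val_enum_ord _) _; rewrite -map_comp.
  by rewrite (@eq_map _ _ _ val) // val_enum_ord mxvec_cast.
rewrite -map_comp -(map_enum_val (fun ij : 'I_m * 'I_n => f (A ij.1 ij.2))).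
apply: eq_map => i /=.
have -> : cast_ord (mxvec_cast m n) i = mxvec_index (enum_val i).1 (enum_val i).2.
  by rewrite /mxvec_index -surjective_pairing enum_valK.
by rewrite mxvecE.
Qed.

Lemma enc_seqE (T : Type) (e : T -> word) s :
  enc_seq e s = flatten [seq true :: e x | x <- s] ++ [:: false].
Proof. by elim: s => //= x s ->; rewrite catA. Qed.

Definition token (q : rat) : word := true :: enc_rat q.

Lemma enc_coord_cV (I : finType) (f : I -> rat) :
  enc_cV (coord_cV f) = flatten [seq token (f i) | i <- enum I] ++ [:: false].
Proof.
rewrite /enc_cV enc_seqE -map_comp -(map_enum_val (fun i => token (f i))); congr (flatten _ ++ _).
by apply: eq_map => i; rewrite /= mxE.
Qed.

Lemma enc_mx_rows (I : finType) n (A : 'M[rat]_(#|I|, n)) (r : I -> 'cV[rat]_n) :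
  (forall i, (row i A)^T%R = r (enum_val i)) ->
  enc_mx A = flatten [seq true :: enc_cV (r i) | i <- enum I] ++ [:: false].
Proof.
move=> rowA; rewrite /enc_mx enc_seqE -(map_enum_val (fun i => true :: enc_cV (r i))).
by congr (flatten _ ++ _); apply: eq_map => i; rewrite rowA.
Qed.

Lemma enc_col_mx (I J : finType) (f : I -> rat) (g : J -> rat) :
  enc_cV (col_mx (coord_cV f) (coord_cV g)) =
  flatten [seq token (f i) | i <- enum I] ++
  flatten [seq token (g i) | i <- enum J] ++ [:: false].
Proof.
rewrite /enc_cV enc_seqE catA -flatten_cat -map_comp; congr (flatten _ ++ _).
have -> : enum 'I_(#|I| + #|J|) =
    [seq lshift _ i | i <- enum 'I_#|I|] ++ [seq rshift _ i | i <- enum 'I_#|J|].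
  apply: (inj_map val_inj); apply: etrans (val_enum_ord _) _.
  rewrite map_cat -[X in _ = X ++ _]map_comp -[X in _ = _ ++ X]map_comp iotaD add0n.
  congr (_ ++ _); first by rewrite -val_enum_ord; apply: eq_map.
  by rewrite -[X in iota X]addn0 iotaDl -val_enum_ord -map_comp; apply: eq_map.
rewrite map_cat -[X in X ++ _ = _]map_comp -[X in _ ++ X = _]map_comp -(map_enum_val (fun i => token (f i))).
rewrite -(map_enum_val (fun i => token (g i))); congr (_ ++ _); apply: eq_map => i /=.
  by rewrite col_mxEu mxE.
by rewrite col_mxEd mxE.
Qed.

Lemma enc_unaryE n : enc_unary n = nseq n true ++ [:: false].
Proof. by elim: n => //= n ->. Qed.

(** Least significant digits come first, so a power of 2 is a run of zeros closed by a one; the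
    length bound can thus be emitted by a loop without any arithmetic. *)
Lemma enc_nat_exp n :
  enc_nat (2 ^ n) = flatten (nseq n [:: true; false]) ++ [:: true; true; false].
Proof.
have -> : enc_nat (2 ^ n) = flatten [seq [:: true; b] | b <- digits (2 ^ n)] ++ [:: false].
  by rewrite /enc_nat enc_seqE.
suff -> : digits (2 ^ n) = nseq n false ++ [:: true].
  by rewrite map_cat map_nseq flatten_cat -catA.
rewrite /digits trunc_expnK // /mkseq -[n.+1]addn1 iotaD map_cat /= divnn expn_gt0 /=.
congr (_ ++ _); apply: (@eq_from_nth _ false); rewrite ?size_map ?size_nseq ?size_iota // => i lt_i.
rewrite (nth_map 0) ?size_iota // nth_iota // nth_nseq lt_i add0n.
by rewrite -expnB ?(ltnW lt_i) // -(subnSK lt_i) expnS oddM.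
Qed.

Lemma flatten_const (A : eqType) (s : seq A) (F : A -> word) (z : word) :
  {in s, forall a, F a = z} -> flatten [seq F a | a <- s] = flatten (nseq (size s) z).
Proof. by move=> /eq_in_map ->; elim: s => //= a s ->. Qed.

Lemma window_blocks K a c (z : word) (F : nat -> word) :
  a + c <= K -> (forall p, p < K -> ~~ (a <= p < a + c) -> F p = z) ->
  flatten [seq F (val p) | p <- enum 'I_K] =
  flatten (nseq a z) ++ flatten [seq F (a + j) | j <- iota 0 c] ++
  flatten (nseq (K - (a + c)) z).
Proof.
move=> le_K out_z; rewrite (map_comp F val) val_enum_ord.
rewrite -{1}(subnKC le_K) iotaD add0n iotaD add0n !map_cat !flatten_cat -catA.
congr (_ ++ (_ ++ _)).
- rewrite (@flatten_const _ _ _ z) ?size_iota // => p; rewrite mem_iota => lt_p.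
  by apply: out_z; lia.
- by rewrite -{1}[a]addn0 iotaDl -map_comp.
- rewrite (@flatten_const _ _ _ z) ?size_iota // => p; rewrite mem_iota => lt_p.
  by apply: out_z; lia.
Qed.

Definition cats : seq gen -> gen := foldr Cat (Lit [::]).

Lemma value_cats x es env : value x (cats es) env = flatten [seq value x e env | e <- es].
Proof. by elim: es => //= e es ->. Qed.

Lemma well_scoped_cats m s es : well_scoped m s (cats es) = all (well_scoped m s) es.
Proof. by elim: es => //= e es ->. Qed.

Lemma value_for x v e env V : nth 0 env v = V ->
  value x (For v e) env = flatten [seq value x e (enter env v (val p)) | p <- enum 'I_V].
Proof.
by move=> /= ->; rewrite -val_enum_ord -map_comp.
Qed.

Lemma value_repeat x v w env :
  value x (For v (Lit w)) env = flatten (nseq (nth 0 env v) w).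
Proof. by rewrite /= (@flatten_const _ _ _ w) ?size_iota. Qed.

Lemma flatten_nseq_nested a b (w : word) :
  flatten (nseq a (flatten (nseq b w))) = flatten (nseq (a * b) w).
Proof. by elim: a => //= a ->; rewrite mulSn nseqD flatten_cat. Qed.

(** * A generator for the code of the instance *)

Section Encoding.
Variables (G : finType) (rule : G * G * G -> G * G * G) (accepting : pred G).
Variables (blank_sym start_sym : G) (bit_sym : bool -> G).

Definition block (b : slot G -> rat) : word :=
  flatten [seq token (b o) | o <- enum {: slot G}].

Definition zeros : word := block (fun=> 0%R).

Definition init_slot (g : G) (o : slot G) : rat :=
  if o is Some (false, g') then (g == g')%:R%R else 0%R.

(** Meant for the body of a loop over the cells in an environment of length 6: counter 6 then holds
    the cell and counter 7 the number of cells after it. *)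
Definition gen_local (b : slot G -> rat) : gen :=
  cats [:: For 6 (Lit zeros); Lit (block b); For 7 (Lit zeros)].

Definition gen_zero_vec v : gen := Cat (For v (Lit zeros)) (Lit [:: false]).

Definition per_slot (e : slot G -> gen) : gen := cats [seq e o | o <- enum {: slot G}].

Definition gen_dim : gen :=
  Cat (For 3 (Lit (nseq #|{: slot G}| true))) (Lit [:: false]).

(** The loop runs over the [k] positions [p] of a window, so counter 7 holds [k - p.+1], and
    [p + 3 + (k - p.+1)] is the number [k.+2] of cells. *)
Definition gen_emb : gen :=
  Cat (For 2 (cats [seq cats [:: Lit [:: true]; For 6 (Lit zeros);
      Lit (flatten [seq block (window_slot rule accepting t j) | j <- iota 0 3]);
      For 7 (Lit zeros); Lit [:: false]] | t <- enum {: G * G * G}]))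
    (Lit [:: false]).

Definition gen_gate : gen :=
  cats [:: Lit [:: false];
    For 3 (per_slot (fun o => gen_local (fun o' => (o == o')%:R%R))); Lit [:: false];
    For 3 (per_slot (fun=> For 4 (per_slot (fun=>
      Cat (Lit [:: true]) (gen_zero_vec 5))))); Lit [:: false]].

Definition gen_inc : gen :=
  cats [:: Lit [:: false]; gen_zero_vec 3;
    For 3 (per_slot (fun o => cats [:: Lit [:: true];
      gen_local (fun o' => (o == o')%:R%R); Lit [:: false]])); Lit [:: false]].

Definition gen_phi : gen :=
  cats [:: Lit [:: false]; gen_zero_vec 3;
    For 3 (per_slot (fun o => cats [:: Lit [:: true];
      gen_local (phi_hidden o); gen_local (phi_input o); Lit [:: false]])); Lit [:: false]].

Definition gen_out : gen :=
  cats [:: Lit (false :: enc_cV (0%R : 'cV[rat]_1)); Lit [:: true];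
    For 3 (Lit (block (@out_slot G))); Lit [:: false]; Lit [:: false]].

Definition gen_init : gen :=
  cats [:: For 1 (Lit (block (init_slot blank_sym))); Lit (block (init_slot start_sym));
    Inp (block (init_slot (bit_sym false))) (block (init_slot (bit_sym true)));
    For 1 (Lit (block (init_slot blank_sym))); Lit (block (init_slot blank_sym));
    Lit [:: false]].

Definition gen_layer (h0 : gen) : gen := cats [:: h0; gen_gate; gen_inc; gen_phi].

Definition gen_instance : gen :=
  cats [:: gen_dim; gen_emb; Lit [:: true]; gen_layer gen_init; Lit [:: true];
    gen_layer (gen_zero_vec 3); Lit [:: false]; gen_out;
    For 3 (Lit (flatten (nseq #|G| [:: true; false]))); Lit [:: true; true; false]].

(** Twelve counters: the six of the initial environment and two for each of at most three nested
    loops. *)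
Lemma well_scoped_instance : well_scoped 12 6 gen_instance.
Proof.
have per m s e : (forall o, well_scoped m s (e o)) -> well_scoped m s (per_slot e).
  by move=> ok; rewrite well_scoped_cats all_map; apply/allP => o _; apply: ok.
have gate_ok : well_scoped 12 6 gen_gate by rewrite /= !per // => o; rewrite /= per.
have inc_ok : well_scoped 12 6 gen_inc by rewrite /= per.
have phi_ok : well_scoped 12 6 gen_phi by rewrite /= per.
have emb_ok : well_scoped 12 6 gen_emb.
  by rewrite /= well_scoped_cats all_map andbT; apply/allP => t _.
have layer_ok h : well_scoped 12 6 h -> well_scoped 12 6 (gen_layer h).
  by move=> ok; rewrite well_scoped_cats /all ok gate_ok inc_ok phi_ok.
by rewrite well_scoped_cats /all emb_ok !layer_ok.
Qed.

Variables (x : word) (B : nat).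
Local Notation n := (size x).
Local Notation k := (2 * B + n).
Local Notation env := [:: n; B; k; k.+2; k.+2; k.+2].

Definition init_string : string k G :=
  [ffun p : 'I_k.+2 =>
     nth blank_sym (nseq B blank_sym ++ start_sym :: map bit_sym x) p].

Lemma enc_index (f : index k G -> rat) :
  flatten [seq token (f i) | i <- enum {: index k G}] =
  flatten [seq block (fun o => f (p, o)) | p <- enum 'I_k.+2].
Proof. by rewrite (enum_prod_map (fun i => token (f i))). Qed.

Lemma enc_local (p : 'I_k.+2) (b : slot G -> rat) :
  flatten [seq token (if p == i.1 then b i.2 else 0%R) | i <- enum {: index k G}] =
  flatten (nseq p zeros) ++ block b ++ flatten (nseq (k.+2 - p.+1) zeros).
Proof.
rewrite enc_index -[p.+1]addn1.
pose F q := if val p == q then block b else zeros.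
have eq_F : map (fun p' : 'I_k.+2 => block (fun o => if p == p' then b o else 0%R))
    (enum 'I_k.+2) = [seq F (val p') | p' <- enum 'I_k.+2].
  by apply: eq_map => p'; rewrite /F /= (inj_eq val_inj); case: eqP.
rewrite eq_F (@window_blocks _ p 1 zeros F) /F /= ?addn0 ?eqxx ?cats0 ?addn1 //.
by move=> q _; case: eqP => // <-; rewrite leqnn ?addn1 ltnSn.
Qed.

Lemma value_local (p : 'I_k.+2) b v : v \in [:: 3; 4; 5] ->
  value x (gen_local b) (enter env v p) =
  flatten (nseq p zeros) ++ block b ++ flatten (nseq (k.+2 - p.+1) zeros).
Proof.
rewrite /gen_local value_cats /map /flatten /foldr !value_repeat => v_in.
have -> : nth 0 (enter env v p) 6 = p.
  by move: v_in; rewrite !inE => /or3P[] /eqP->.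
have -> : nth 0 (enter env v p) 7 = k.+2 - p.+1.
  by move: v_in; rewrite !inE => /or3P[] /eqP->.
by rewrite cats0.
Qed.

Lemma value_per_slot e env' :
  value x (per_slot e) env' = flatten [seq value x (e o) env' | o <- enum {: slot G}].
Proof. by rewrite /per_slot value_cats -map_comp. Qed.

Lemma value_for_slot e (r : index k G -> word) :
  (forall p o, value x (e o) (enter env 3 (val p)) = r (p, o)) ->
  value x (For 3 (per_slot e)) env = flatten [seq r i | i <- enum {: index k G}].
Proof.
move=> eq_r; rewrite (@value_for _ _ _ _ k.+2) // enum_prod_map.
congr flatten; apply: eq_map => p; rewrite value_per_slot.
by congr flatten; apply: eq_map => o; rewrite eq_r.
Qed.

Lemma card_index : #|{: index k G}| = k.+2 * #|{: slot G}|.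
Proof. by rewrite card_prod card_ord. Qed.

Lemma value_dim : value x gen_dim env = enc_unary #|{: index k G}|.
Proof.
rewrite enc_unaryE card_index.
rewrite -[LHS]/(value x (For 3 (Lit (nseq #|{: slot G}| true))) env ++ [:: false]).
rewrite value_repeat -[nth _ _ _]/(k.+2).
by congr (_ ++ _); elim: k.+2 => //= m ->; rewrite mulSn nseqD.
Qed.

Lemma enc_zero_vec :
  enc_cV (0%R : 'cV[rat]_#|{: index k G}|) = flatten (nseq k.+2 zeros) ++ [:: false].
Proof.
have -> : 0%R = coord_cV (fun _ : index k G => 0%R : rat) by apply/colP => i; rewrite !mxE.
rewrite enc_coord_cV (@enc_index (fun=> 0%R)) (@flatten_const _ _ _ zeros) //.
by rewrite size_enum_ord.
Qed.

Lemma value_zero_vec v env' : nth 0 env' v = k.+2 ->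
  value x (gen_zero_vec v) env' = enc_cV (0%R : 'cV[rat]_#|{: index k G}|).
Proof.
move=> eq_v; rewrite enc_zero_vec -eq_v -(value_repeat x); reflexivity.
Qed.

Lemma enc_local_mx w :
  enc_mx (@local_mx k G w) =
  flatten [seq true :: enc_cV (coord_cV (fun j : index k G =>
                 if i.1 == j.1 then w i.2 j.2 else 0%R)) | i <- enum {: index k G}] ++
  [:: false].
Proof.
apply: (enc_mx_rows (r := fun i => coord_cV (fun j : index k G =>
  if i.1 == j.1 then w i.2 j.2 else 0%R))) => i.
by apply/colP => j; rewrite !mxE.
Qed.

Lemma enc_zero_mx d m : enc_mx (0%R : 'M[rat]_(d, m)) =
  flatten (nseq d (true :: enc_cV (0%R : 'cV[rat]_m))) ++ [:: false].
Proof.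
rewrite /enc_mx enc_seqE (@flatten_const _ _ _ (true :: enc_cV (0%R : 'cV[rat]_m))).
  by rewrite size_enum_ord.
by move=> i _; rewrite row0 trmx0.
Qed.

Lemma enc_mxvec1 : enc_cV (mxvec (1%:M : 'M[rat]_#|{: index k G}|))^T%R =
  flatten [seq flatten [seq token (if i.1 == j.1 then (i.2 == j.2)%:R%R else 0%R)
                       | j <- enum {: index k G}] | i <- enum {: index k G}] ++ [:: false].
Proof.
rewrite /enc_cV enc_seqE -map_comp; congr (_ ++ _).
rewrite (eq_map (g := fun i => token (mxvec (1%:M : 'M[rat]_#|{: index k G}|)%R ord0 i)));
  last by move=> i; rewrite /= mxE.
rewrite map_mxvec enum_prod_map.
rewrite -(map_enum_val (fun i => flatten [seq token
  (if i.1 == j.1 then (i.2 == j.2)%:R%R else 0%R) | j <- enum {: index k G}])).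
congr flatten; apply: eq_map => a.
rewrite -(map_enum_val (fun j => token
  (if (enum_val a).1 == j.1 then ((enum_val a).2 == j.2)%:R%R else 0%R))).
congr flatten; apply: eq_map => b; rewrite mxE -(inj_eq enum_val_inj) /=.
by case: (enum_val a) (enum_val b) => [p o] [p' o']; rewrite xpair_eqE /=; case: (p == p').
Qed.

Lemma value_gate (h0 : index k G -> rat) :
  value x gen_gate env = enc_fnn (sl_gate (rewriting_layer h0)).
Proof.
set W := true :: enc_cV (0%R : 'cV[rat]_#|{: index k G}|).
have id_rows : value x (For 3 (per_slot (fun o => gen_local (fun o' => (o == o')%:R%R)))) env =
    flatten [seq flatten [seq token (if i.1 == j.1 then (i.2 == j.2)%:R%R else 0%R)
                         | j <- enum {: index k G}] | i <- enum {: index k G}].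
  apply: (value_for_slot (r := fun i => flatten [seq token
    (if i.1 == j.1 then (i.2 == j.2)%:R%R else 0%R) | j <- enum {: index k G}])) => p o.
  by rewrite value_local // (enc_local p (fun o' => (o == o')%:R%R)).
have zero_rows : value x (For 3 (per_slot (fun=> For 4 (per_slot (fun=>
      Cat (Lit [:: true]) (gen_zero_vec 5)))))) env =
    flatten (nseq (#|{: index k G}| * #|{: index k G}|) W).
  rewrite (@value_for _ _ _ _ k.+2) // (@flatten_const _ _ _ (flatten
    (nseq #|{: slot G}| (flatten (nseq #|{: index k G}| W))))) => [|p _].
    by rewrite size_enum_ord flatten_nseq_nested -card_index flatten_nseq_nested.
  rewrite value_per_slot (@flatten_const _ _ _ (flatten (nseq #|{: index k G}| W))) ?cardE // => o _.
  rewrite (@value_for _ _ _ _ k.+2) // (@flatten_const _ _ _ (flatten (nseq #|{: slot G}| W))) => [|q _].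
    by rewrite size_enum_ord flatten_nseq_nested -card_index cardE.
  rewrite value_per_slot (@flatten_const _ _ _ W) ?cardE // => o' _.
  by rewrite -[LHS]/(true :: value x (gen_zero_vec 5) _) value_zero_vec.
rewrite [enc_fnn _]/= /gen_gate value_cats /map /flatten /foldr cats0 id_rows zero_rows.
by rewrite enc_mxvec1 enc_zero_mx -/W -!catA.
Qed.

Lemma value_inc (h0 : index k G -> rat) :
  value x gen_inc env = enc_fnn (sl_inc (rewriting_layer h0)).
Proof.
rewrite [enc_fnn _]/= /gen_inc value_cats /map /flatten /foldr cats0.
rewrite value_zero_vec // enc_local_mx.
rewrite (value_for_slot (r := fun i => true :: enc_cV (coord_cV (fun j : index k G =>
                 if i.1 == j.1 then (i.2 == j.2)%:R%R else 0%R)))) //.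
move=> p o; rewrite value_cats /map /flatten /foldr value_local // enc_coord_cV.
by rewrite (enc_local p (fun o' => (o == o')%:R%R)) cats0.
Qed.

Lemma value_phi (h0 : index k G -> rat) :
  value x gen_phi env = enc_fnn (sl_phi (rewriting_layer h0)).
Proof.
rewrite [enc_fnn _]/= /gen_phi value_cats /map /flatten /foldr cats0.
rewrite value_zero_vec //.
pose r (w : slot G -> slot G -> rat) (i j : index k G) := if i.1 == j.1 then w i.2 j.2 else 0%R.
rewrite (enc_mx_rows (r := fun i : index k G =>
  col_mx (coord_cV (r (@phi_hidden G) i)) (coord_cV (r (@phi_input G) i)))); last first.
  move=> i; rewrite row_row_mx tr_row_mx; congr col_mx; apply/colP => j; rewrite !mxE //.
rewrite (value_for_slot (r := fun i => true ::
  enc_cV (col_mx (coord_cV (r (@phi_hidden G) i)) (coord_cV (r (@phi_input G) i))))) //.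
move=> p o; rewrite value_cats /map /flatten /foldr !value_local // enc_col_mx.
by rewrite (enc_local p (phi_hidden o)) (enc_local p (phi_input o)) cats0 -!catA.
Qed.

Lemma value_out (s : string k G) :
  value x gen_out env = enc_fnn (sm_out (rewriting_ssm rule accepting s)).
Proof.
rewrite [enc_fnn _]/= /gen_out value_cats /map /flatten /foldr cats0.
rewrite -[LHS]/(false :: enc_cV (0%R : 'cV[rat]_1) ++ (true ::
  value x (For 3 (Lit (block (@out_slot G)))) env ++ [:: false; false])).
congr (_ :: _ ++ _); rewrite value_repeat /enc_mx enum_ordSl enum_ord0 /=.
have -> : (row ord0 (\row_i out_slot (enum_val i).2))^T%R =
    coord_cV (fun i : index k G => out_slot i.2).
  by apply/colP => j; rewrite !mxE.
rewrite enc_coord_cV (@enc_index (fun i => out_slot i.2)).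
by rewrite (@flatten_const _ _ _ (block (@out_slot G))) ?size_enum_ord //= -!catA.
Qed.

Lemma value_emb (s : string k G) : value x gen_emb env =
  enc_seq (@enc_cV _) [seq sm_emb (rewriting_ssm rule accepting s) a | a <- enum 'I_#|{: letter k G}|].
Proof.
rewrite enc_seqE -map_comp.
rewrite (eq_map (g := fun a => true :: enc_cV (coord_cV (emb_coord rule accepting (enum_val a)))));
  last by move=> a /=; rewrite ffunE.
rewrite (map_enum_val (fun l : letter k G => true :: enc_cV (coord_cV (emb_coord rule accepting l)))).
rewrite enum_prod_map -[LHS]/(value x (For 2 _) env ++ [:: false]); congr (_ ++ _).
rewrite (@value_for _ _ _ _ k) //; congr flatten; apply: eq_map => p.
rewrite value_cats -map_comp; congr flatten; apply: eq_map => t.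
rewrite /comp value_cats /map /flatten /foldr !value_repeat cats0 enc_coord_cV enc_index.
set bs := map _ (enum 'I_k.+2).
have -> : bs = [seq (fun q => if p <= q < p + 3
    then block (window_slot rule accepting t (q - p)) else zeros) (val q) | q <- enum 'I_k.+2].
  by apply: eq_map => q; rewrite /emb_coord /=; case: ifP.
have lt_p : p + 3 <= k.+2 by have := ltn_ord p; lia.
rewrite (@window_blocks _ p 3 zeros (fun q => if p <= q < p + 3
    then block (window_slot rule accepting t (q - p)) else zeros)) //; last first.
  by move=> q _ /negPf ->.
rewrite /= addn0 leqnn subnn !ltn_add2l !leq_addr !addKn /= -!catA.
have -> : p < p + 3 by rewrite addn3 ltnS leqW.
by rewrite addn3 !subSS.
Qed.

Lemma value_init : value x gen_init env = enc_cV (coord_cV (init_coord init_string)).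
Proof.
have nth_pad (L : seq G) K : size L <= K ->
    [seq nth blank_sym L p | p <- iota 0 K] = L ++ nseq (K - size L) blank_sym.
  move=> le_L; apply: (@eq_from_nth _ blank_sym).
    by rewrite size_map size_iota size_cat size_nseq subnKC.
  move=> i; rewrite size_map size_iota => lt_i.
  rewrite (nth_map 0) ?size_iota // nth_iota // nth_cat nth_nseq if_same.
  by case: ltnP => // /(nth_default blank_sym).
rewrite enc_coord_cV (enc_index (init_coord init_string)).
pose L := nseq B blank_sym ++ start_sym :: map bit_sym x.
have -> : [seq block (fun o => init_coord init_string (p, o)) | p <- enum 'I_k.+2] =
    [seq block (init_slot g) | g <- [seq nth blank_sym L p | p <- iota 0 k.+2]].
  rewrite -val_enum_ord -!map_comp; apply: eq_map => p /=.
  by congr flatten; apply: eq_map => -[[[] g]|] //; rewrite /init_coord /= ffunE.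
have size_L : size L = B + n.+1 by rewrite size_cat size_nseq /= size_map.
have -> : [seq nth blank_sym L p | p <- iota 0 k.+2] = L ++ nseq B.+1 blank_sym.
  have eq_pad : k.+2 - size L = B.+1 by rewrite size_L; lia.
  by rewrite -eq_pad; apply: nth_pad; rewrite size_L; lia.
pose b0 := block (init_slot blank_sym).
have -> : value x gen_init env = flatten (nseq B b0) ++ block (init_slot start_sym) ++
    flatten [seq if b then block (init_slot (bit_sym true))
                 else block (init_slot (bit_sym false)) | b <- x] ++
    flatten (nseq B b0) ++ b0 ++ [:: false].
  by rewrite -[LHS]/(value x (For 1 (Lit b0)) env ++ _ ++ _ ++
    (value x (For 1 (Lit b0)) env ++ _ ++ _ ++ [::])) !value_repeat cats0.
rewrite /L -[B.+1]addn1 nseqD !map_cat !flatten_cat !map_nseq -/b0 /= -map_comp cats0 -!catA.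
by congr (_ ++ (_ ++ (flatten _ ++ _))); apply: eq_map => -[].
Qed.

Lemma value_layer g (h0 : index k G -> rat) :
  value x g env = enc_cV (coord_cV h0) ->
  value x (gen_layer g) env = enc_layer (rewriting_layer h0).
Proof.
move=> eq_g; rewrite -[LHS]/(value x g env ++ value x gen_gate env ++
  value x gen_inc env ++ value x gen_phi env ++ [::]).
by rewrite eq_g (value_gate h0) (value_inc h0) (value_phi h0) cats0.
Qed.

Lemma value_instance : value x gen_instance env =
  enc_instance (rewriting_ssm rule accepting init_string, 2 ^ (k.+2 * #|G|)).
Proof.
pose digit_pairs := flatten (nseq #|G| [:: true; false]).
rewrite -[LHS]/(value x gen_dim env ++ value x gen_emb env ++
  true :: value x (gen_layer gen_init) env ++ true :: value x (gen_layer (gen_zero_vec 3)) env ++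
  false :: value x gen_out env ++ value x (For 3 (Lit digit_pairs)) env ++ [:: true; true; false]).
rewrite value_dim (value_emb init_string) (value_out init_string).
rewrite (value_layer value_init) (@value_layer _ (fun=> 0%R)); last first.
  by rewrite value_zero_vec //; congr enc_cV; apply/colP => i; rewrite !mxE.
rewrite value_repeat flatten_nseq_nested.
have -> : enc_instance (rewriting_ssm rule accepting init_string, 2 ^ (k.+2 * #|G|)) =
    (enc_unary #|{: index k G}| ++ enc_seq (@enc_cV _) [seq sm_emb
        (rewriting_ssm rule accepting init_string) a | a <- enum 'I_#|{: letter k G}|] ++
     (true :: enc_layer (rewriting_layer (init_coord init_string)) ++
      true :: enc_layer (rewriting_layer (fun _ : index k G => 0%R)) ++ [:: false]) ++
     enc_fnn (sm_out (rewriting_ssm rule accepting init_string))) ++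
    enc_nat (2 ^ (k.+2 * #|G|)) by [].
by rewrite enc_nat_exp -!catA cat_cons -!catA cat_cons -!catA.
Qed.

End Encoding.

(** * The reduction *)

Lemma size_enc_seq_map (T I : Type) (e : T -> word) (f : I -> T) b (s : seq I) :
  (forall i, size (e (f i)) <= b) ->
  size (enc_seq e [seq f i | i <- s]) <= size s * b.+1 + 1.
Proof.
move=> le_b; elim: s => //= i s IH; rewrite size_cat.
by have := le_b i; move: IH; rewrite mulSn; lia.
Qed.

Definition sign_like (q : rat) : bool := q \in [:: 0; 1; -1]%R.

Definition sign_size : nat :=
  (maxn (size (enc_rat 0%R)) (maxn (size (enc_rat 1%R)) (size (enc_rat (-1)%R)))).+1.

Lemma size_enc_cV m (v : 'cV[rat]_m) : (forall i, sign_like (v i ord0)) ->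
  size (enc_cV v) <= m * sign_size + 1.
Proof.
move=> small; rewrite -{2}(size_enum_ord m); apply: size_enc_seq_map => i.
by have := small i; rewrite /sign_like !inE !leq_max => /or3P[] /eqP->; rewrite leqnn ?orbT.
Qed.

Lemma size_enc_mx m n (A : 'M[rat]_(m, n)) : (forall i j, sign_like (A i j)) ->
  size (enc_mx A) <= m * (n * sign_size + 2) + 1.
Proof.
move=> small; have := @size_enc_seq_map _ _ (fun i => enc_cV (row i A)^T%R) id
  (n * sign_size + 1) (enum 'I_m).
rewrite map_id size_enum_ord -addnS; apply=> i; apply: size_enc_cV => j.
by rewrite !mxE.
Qed.

Lemma sign_like_nat (b : bool) : sign_like b%:R%R.
Proof. by case: b. Qed.

Section EncodingSize.
Variables (k : nat) (G : finType) (rule : G * G * G -> G * G * G) (accepting : pred G).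
Local Notation d := #|{: index k G}|.

Definition layer_bound d := d * sign_size + 1 +
  ((d * d * sign_size + 1) + (d * d * (d * sign_size + 2) + 1) + 1 +
   ((d * sign_size + 1) + (d * (d * sign_size + 2) + 1) + 1 +
    ((d * sign_size + 1) + (d * ((d + d) * sign_size + 2) + 1) + 1))).

Definition ssm_bound t := t + 1 + ((t * (t * sign_size + 1).+1 + 1) +
  ((2 * (layer_bound t).+1 + 1) + ((sign_size + 1) + (t * sign_size + 2 + 1) + 1))).

Lemma size_enc_layer (h0 : index k G -> rat) : (forall i, sign_like (h0 i)) ->
  size (enc_layer (rewriting_layer h0)) <= layer_bound d.
Proof.
move=> small; rewrite /enc_layer !size_cat /=.
have small0 m n i j : sign_like ((0 : 'M[rat]_(m, n))%R i j) by rewrite mxE.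
apply: leq_add; first by apply: size_enc_cV => i; rewrite mxE.
apply: leq_add; last apply: leq_add; rewrite size_cat -addn1 leq_add2r; apply: leq_add;
  first [apply: size_enc_cV|apply: size_enc_mx] => // i.
- by rewrite mxE; case/mxvec_indexP: i => i j; rewrite mxvecE mxE sign_like_nat.
- by move=> j; rewrite mxE; case: ifP => // _; apply: sign_like_nat.
move=> j; rewrite -(splitK j); case: (split j) => {}j /=; rewrite ?row_mxEl ?row_mxEr mxE;
  case: ifP => // _; case: (enum_val i).2 => [[[] g]|] //=; rewrite ?sign_like_nat //.
by case: (_ == _); case: (_ == _).
Qed.

Lemma size_enc_rewriting_ssm (s : string k G) :
  size (enc_ssm (rewriting_ssm rule accepting s)) <=
  ssm_bound (ssm_size (rewriting_ssm rule accepting s)).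
Proof.
set S := rewriting_ssm rule accepting s.
have small0 m n i j : sign_like ((0 : 'M[rat]_(m, n))%R i j) by rewrite mxE.
have le_d : d <= ssm_size S by rewrite leq_addl.
have le_sigma : #|{: letter k G}| <= ssm_size S by rewrite /ssm_size -addnA leq_addr.
have le_layer : layer_bound d <= layer_bound (ssm_size S).
  by rewrite /layer_bound; repeat (first [apply: leq_add|apply: leq_mul]).
rewrite /enc_ssm !size_cat; apply: leq_add.
  by rewrite enc_unaryE size_cat size_nseq leq_add2r.
apply: leq_add.
  apply: leq_trans (size_enc_seq_map (b := d * sign_size + 1) _ _) _ => [a|].
    apply: size_enc_cV => i; rewrite ffunE mxE /emb_coord; case: ifP => // _.
    by rewrite /window_slot; case: (_.2) => [[c g]|]; apply: sign_like_nat.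
  rewrite size_enum_ord leq_add2r leq_mul // ltnS leq_add2r leq_mul2r.
  by rewrite le_d orbT.
apply: leq_add.
  have le1 : size (enc_layer (rewriting_layer (init_coord s))) <= layer_bound d.
    apply: size_enc_layer => i; rewrite /init_coord.
    by case: (i.2) => [[[] g]|] //; apply: sign_like_nat.
  have le2 : size (enc_layer (rewriting_layer (fun _ : index k G => 0%R))) <= layer_bound d.
    exact: size_enc_layer.
  rewrite -[enc_seq _ _]/(true :: enc_layer (rewriting_layer (init_coord s)) ++
    true :: enc_layer (rewriting_layer (fun _ : index k G => 0%R)) ++ [:: false]).
  by rewrite /= size_cat /= size_cat /=; lia.
rewrite /= size_cat -addn1 leq_add2r; apply: leq_add.
  by apply: leq_trans (size_enc_cV _) _ => //; rewrite mul1n.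
apply: leq_trans (size_enc_mx _) _ => [i j|].
  by rewrite mxE /out_slot; case: (_.2) => [[[] g]|].
by rewrite mul1n !leq_add2r leq_mul2r le_d orbT.
Qed.

End EncodingSize.

Lemma poly_bounded_ssm_bound : poly_bounded ssm_bound.
Proof.
have poly_id := poly_bounded_id; have poly_c a := poly_bounded_const a.
have poly_S f : poly_bounded f -> poly_bounded (fun n => (f n).+1).
  move=> poly_f; apply: poly_bounded_le (poly_bounded_add poly_f (poly_c 1)) => n.
  by rewrite addn1.
rewrite /ssm_bound /layer_bound.
repeat (first [exact: poly_c|done|apply: poly_bounded_add|apply: poly_bounded_mul|apply: poly_S]).
Qed.

(** Replaces the space bound by a pure power, which [power] computes by repeated multiplication. *)
Lemma poly_bound_le_exp c n : poly_bound c n <= n.+2 ^ c.+1.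
Proof.
rewrite /poly_bound expnS.
have le1 : n ^ c <= n.+2 ^ c by case: c => // c; rewrite leq_exp2r //; lia.
have le2 : c <= n.+2 ^ c by rewrite ltnW // ltn_expl.
by nia.
Qed.

Theorem theorem10 (R : realType) :
  exists c : nat, PSPACE_hard (ssmSAT_le_bin R (diag_class R c)).
Proof.
(* [ssm_bound] does not mention the machine, so one exponent serves all problems [A]. *)
have [c0 le_c0] := poly_bounded_poly_bound poly_bounded_ssm_bound.
exists c0 => A [M [c M_decides]].
pose bit_symbol (b : bool) : tm_state M + symbol (tm_work M) := inr (Some (inl b)).
pose e := gen_instance (@machine_rule M) (@accepting_symbol M) (blank M)
  (inl (tm_start M)) bit_symbol.
pose B n := n.+2 ^ c.+1; pose k n := 2 * B n + n.
pose f x := let n := size x in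
  value x e [:: n; B n; k n; (k n).+2; (k n).+2; (k n).+2].
exists f.
  by apply: (@polytime_reduction 12 c e) => //; apply: well_scoped_instance.
move=> x; pose n := size x.
pose s := init_string (blank M) (inl (tm_start M)) bit_symbol x (B n).
exists (rewriting_ssm (@machine_rule M) (@accepting_symbol M) s,
  2 ^ ((k n).+2 * #|{: tm_state M + symbol (tm_work M)}|)); split.
- split; first exact: rewriting_diagonal.
  exact: leq_trans (size_enc_rewriting_ssm _ _ _) (le_c0 _).
- exact: value_instance.
have [space_x [t [halt_t acc_t]]] := M_decides x.
have space_B u : tm_space (iter u (@tm_step 0 M) (tm_init M x)) <= B n.
  exact: leq_trans (space_x u) (poly_bound_le_exp c n).
(* On the empty input [tm_init] lists a blank under the head, which the initial string has only as
   padding. *)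
have input_cells (y : word) q : nth (blank M) (inl (tm_start M) :: map bit_symbol y) q =
    nth (blank M) (inl (tm_start M) ::
      map inr (tape_head (cf_tape (tm_init M y) ord0) ::
               tape_right (cf_tape (tm_init M y) ord0))) q.
  case: y => [|b y] /=; first by case: q => [|[|q]] //=; rewrite nth_nil.
  by rewrite -map_comp.
have shows_init : shows (B n) s (tm_init M x).
  exists (B n); split=> // [|p].
    by rewrite -addn1 leq_add2l tm_space1.
  rewrite ffunE /layout /= !(nth_cat _ (nseq _ _)); case: ltnP => // _.
have le_Bk : 2 * B n <= k n by rewrite leq_addr.
apply: iff_trans (iff_sym (short_accepting_word _ _ R s)).
rewrite -acc_t; split=> [acc|[w [l [val_w acc_l]]]].
  exact: (valid_complete le_Bk space_B shows_init halt_t acc).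
have [u /andP[halt_u acc_u]] := valid_sound le_Bk space_B shows_init val_w acc_l.
(* The halting time [u] found by the rewriting and the time [t] at which the machine decides [A] may
   differ; as halted configurations are fixed, both runs agree at time [t + u]. *)
have halted_stable c' v : tm_halted c' -> iter v (@tm_step 0 M) c' = c'.
  by move=> halt_c'; elim: v => //= v ->; rewrite /tm_step -/(tm_halted c') halt_c'.
have : iter (t + u) (@tm_step 0 M) (tm_init M x) = iter (u + t) (@tm_step 0 M) (tm_init M x).
  by rewrite addnC.
rewrite !iterD (halted_stable _ t halt_u) (halted_stable _ u halt_t) => eq_run.
by move: acc_u; rewrite eq_run.
Qed.
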